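(* Let $\lambda\in X^+(\infty)$. Then there are $\mathbf U(\infty)$-module isomorphisms $$L(\lambda)\cong\varinjlim_n L(\lambda_{[-n,n]})\cong M(\lambda)/I(\lambda).$$
   Context: $v$ indeterminate, $[t]=\frac{v^t-v^{-t}}{v-v^{-1}}$, $[m]^!=[1]\cdots[m]$. $\mathbf U(\infty)$ is the $\mathbb Q(v)$-algebra with generators $E_i,F_i,K_i,K_i^{-1}$ ($i\in\mathbb Z$) and relations: $K_iK_j=K_jK_i$, $K_iK_i^{-1}=1$; $K_iE_j=v^{\delta_{i,j}-\delta_{i,j+1}}E_jK_i$; $K_iF_j=v^{\delta_{i,j+1}-\delta_{i,j}}F_jK_i$; $E_iE_j=E_jE_i$, $F_iF_j=F_jF_i$ if $|i-j|>1$; $E_iF_j-F_jE_i=\delta_{i,j}\frac{\widetilde K_i-\widetilde K_i^{-1}}{v-v^{-1}}$, $\widetilde K_i=K_iK_{i+1}^{-1}$; $E_i^2E_j-(v+v^{-1})E_iE_jE_i+E_jE_i^2=0$ and likewise for $F$ if $|i-j|=1$. $\mathbf U^-(\infty)$ is the subalgebra generated by the $F_i$; $F_i^{(m)}=F_i^m/[m]^!$. For $n\ge1$, $\mathbf U([-n,n])$ is the subalgebra generated by $E_i,F_i$ ($-n\le i<n$) and $K_j^{\pm1}$ ($-n\le j\le n$). $X^+(\infty)$ is the set of integer sequences $(\lambda_i)_{i\in\mathbb Z}$ with $\lambda_i\ge\lambda_{i+1}$ for all $i$. For $\lambda\in X^+(\infty)$: $M(\lambda)=\mathbf U(\infty)/(\sum_i\mathbf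 U(\infty)E_i+\sum_i\mathbf U(\infty)(K_i-v^{\lambda_i}))=\mathbf U^-(\infty)1_\lambda$, where $1_\lambda$ is the image of $1$; $M(\lambda)$ has a unique maximal submodule and $L(\lambda)$ is its irreducible quotient. $I(\lambda)=\sum_{i\in\mathbb Z}\mathbf U^-(\infty)F_i^{(\lambda_i-\lambda_{i+1}+1)}1_\lambda$. With $\lambda_{[-n,n]}=(\lambda_i)_{-n\le i\le n}$, let $I_n(\lambda_{[-n,n]})$ be the left ideal of $\mathbf U([-n,n])$ generated by $E_i$, $F_i^{\lambda_i-\lambda_{i+1}+1}$ ($-n\le i<n$) and $K_j-v^{\lambda_j}$ ($-n\le j\le n$), and $L(\lambda_{[-n,n]})=\mathbf U([-n,n])/I_n(\lambda_{[-n,n]})$ (the finite-dimensional irreducible $\mathbf U([-n,n])$-module of highest weight $\lambda_{[-n,n]}$). Since $I_n\subseteq I_{n+1}$, the maps $u+I_n\mapsto u+I_{n+1}$ ($u\in\mathbf U([-n,n])$) form a direct system, whose direct limit $\varinjlim_nL(\lambda_{[-n,n]})$ is naturally a $\mathbf U(\infty)$-module. *)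

(* Defs.v *)
From HB Require Import structures.
From mathcomp Require Import all_boot all_order all_algebra.
From mathcomp Require Import fraction.
From mathcomp.multinomials Require Import monalg.
From Stdlib Require Import ClassicalEpsilon.

Set Implicit Arguments.
Unset Strict Implicit.
Unset Printing Implicit Defensive.
Import Order.TTheory GRing.Theory Num.Theory.
Local Open Scope ring_scope.

Definition Qv := {fraction {poly rat}}.
Definition qv : Qv := tofrac ('X : {poly rat}).
Definition qint (t : int) : Qv := (qv ^ t - qv ^ (- t)) / (qv - qv^-1).
Definition qfact (m : nat) : Qv := \prod_(1 <= t < m.+1) qint t%:Z.

(* Free algebra over Q(v) on the generators E_i, F_i, K_i, K_i^{-1} (i in Z). *)
(* A generator is a pair (tag, i) with tag 0 = E, 1 = F, 2 = K, 3 = K^{-1}.  *)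
Definition gen := ('I_4 * int)%type.
Definition tE : 'I_4 := @Ordinal 4 0 isT.
Definition tF : 'I_4 := @Ordinal 4 1 isT.
Definition tK : 'I_4 := @Ordinal 4 2 isT.
Definition tKi : 'I_4 := @Ordinal 4 3 isT.

Definition FA := {malg Qv[fmonom gen]}.
Definition fgen (g : gen) : FA := << fmu g >>.
Definition fE (i : int) : FA := fgen (tE, i).
Definition fF (i : int) : FA := fgen (tF, i).
Definition fK (i : int) : FA := fgen (tK, i).
Definition fKi (i : int) : FA := fgen (tKi, i).
Definition fKt (i : int) : FA := fK i * fKi (i + 1).
Definition fKti (i : int) : FA := fKi i * fK (i + 1).
Definition dlt (i j : int) : int := (i == j)%:R.

(* The defining relations of U(infinity), as elements r of FA (meaning r = 0). *)
Definition Urel (r : FA) : Prop :=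
  (exists i j, r = fK i * fK j - fK j * fK i) \/
  (exists i, r = fK i * fKi i - 1) \/
  (exists i, r = fKi i * fK i - 1) \/
  (exists i j, r = fK i * fE j - (qv ^ (dlt i j - dlt i (j + 1))) *: (fE j * fK i)) \/
  (exists i j, r = fK i * fF j - (qv ^ (dlt i (j + 1) - dlt i j)) *: (fF j * fK i)) \/
  (exists i j, 1 < `|i - j| /\ r = fE i * fE j - fE j * fE i) \/
  (exists i j, 1 < `|i - j| /\ r = fF i * fF j - fF j * fF i) \/
  (exists i j, r = fE i * fF j - fF j * fE i
                   - (dlt i j)%:~R *: ((qv - qv^-1)^-1 *: (fKt i - fKti i))) \/
  (exists i j, `|i - j| = 1 /\
     r = fE i ^+ 2 * fE j - (qv + qv^-1) *: (fE i * fE j * fE i) + fE j * fE i ^+ 2) \/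
  (exists i j, `|i - j| = 1 /\
     r = fF i ^+ 2 * fF j - (qv + qv^-1) *: (fF i * fF j * fF i) + fF j * fF i ^+ 2).

Record space := Space {
  car :> Type;
  szero : car;
  sadd : car -> car -> car;
  sopp : car -> car;
  sscale : Qv -> car -> car }.

Record umod := UMod { usp :> space; uact : FA -> usp -> usp }.

(* A U(infinity)-module isomorphism: a linear bijection commuting with the  *)
(* action of (every element of the free algebra mapping onto) U(infinity). *)
Definition umod_iso (M N : umod) : Prop :=
  exists f : M -> N,
    bijective f /\
    (forall x y, f (sadd x y) = sadd (f x) (f y)) /\
    (forall c x, f (sscale c x) = sscale c (f x)) /\
    (forall a x, f (uact a x) = uact a (f x)).

Definition span (V : space) (P : V -> Prop) (x : V) : Prop :=
  forall S : V -> Prop, S (szero V) ->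
    (forall y z, S y -> S z -> S (sadd y z)) ->
    (forall y, S y -> S (sopp y)) ->
    (forall c y, S y -> S (sscale c y)) ->
    (forall y, P y -> S y) -> S x.

Lemma span0 (V : space) (P : V -> Prop) : span P (szero V).
Proof. by move=> S H0. Qed.
Lemma spanD (V : space) (P : V -> Prop) x y :
  span P x -> span P y -> span P (sadd x y).
Proof. by move=> hx hy S H0 HD HN HZ HP; exact: (HD _ _ (hx S H0 HD HN HZ HP) (hy S H0 HD HN HZ HP)). Qed.
Lemma spanN (V : space) (P : V -> Prop) x : span P x -> span P (sopp x).
Proof. by move=> hx S H0 HD HN HZ HP; exact: (HN _ (hx S H0 HD HN HZ HP)). Qed.
Lemma spanZ (V : space) (P : V -> Prop) c x : span P x -> span P (sscale c x).
Proof. by move=> hx S H0 HD HN HZ HP; exact: (HZ _ _ (hx S H0 HD HN HZ HP)). Qed.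

Definition submodule (M : umod) (P : M -> Prop) : Prop :=
  [/\ P (szero M), (forall x y, P x -> P y -> P (sadd x y)),
      (forall x, P x -> P (sopp x)), (forall c x, P x -> P (sscale c x))
    & (forall a x, P x -> P (uact a x))].

Section Quotient.
Variables (M : umod) (P : M -> Prop).

Definition qcls (x : M) : M -> Prop := fun y => span P (sadd y (sopp x)).
Definition qcar := {X : M -> Prop | exists x, X = qcls x}.
Definition qmk (x : M) : qcar := exist _ (qcls x) (ex_intro _ x erefl).
Definition qrep (X : qcar) : M :=
  proj1_sig (constructive_indefinite_description _ (proj2_sig X)).

Definition qspace : space :=
  @Space qcar (qmk (szero M))
    (fun X Y => qmk (sadd (qrep X) (qrep Y)))
    (fun X => qmk (sopp (qrep X)))
    (fun c X => qmk (sscale c (qrep X))).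

Definition qumod : umod := @UMod qspace (fun a X => qmk (uact a (qrep X))).
End Quotient.

(* Subspace span(P) of a space, with the restricted action (meaningful for  *)
(* those a which preserve the subspace).                                    *)
Section Subspace.
Variables (M : umod) (P : M -> Prop).

Definition scar := {x : M | span P x}.
Definition sspace : space :=
  @Space scar (exist (fun x => span P x) (szero M) (@span0 M P))
    (fun x y => exist (fun x => span P x) (sadd (proj1_sig x) (proj1_sig y))
                  (@spanD M P _ _ (proj2_sig x) (proj2_sig y)))
    (fun x => exist (fun x => span P x) (sopp (proj1_sig x)) (@spanN M P _ (proj2_sig x)))
    (fun c x => exist (fun x => span P x) (sscale c (proj1_sig x))
                  (@spanZ M P c _ (proj2_sig x))).

Definition sact (a : FA) (x : scar) : scar :=
  match excluded_middle_informative (span P (uact a (proj1_sig x))) with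
  | left h => exist (fun x => span P x) _ h
  | right _ => x
  end.

Definition sumod : umod := @UMod sspace sact.
End Subspace.

Section DirectLimit.
Variables (L : nat -> umod) (f : forall n, L n -> L n.+1) (lev : FA -> nat).

Fixpoint up (n d : nat) : L n -> L (Nat.add d n) :=
  match d return L n -> L (Nat.add d n) with
  | 0 => fun x => x
  | d'.+1 => fun x => @f (Nat.add d' n) (@up n d' x) end.

Definition drel (p q : {n : nat & L n}) : Prop :=
  exists d e (H : Nat.add d (tag p) = Nat.add e (tag q)),
    eq_rect _ L (up d (tagged p)) _ H = up e (tagged q).

Definition dcar := {X : {n : nat & L n} -> Prop | exists p, X = drel p}.
Definition dmk (p : {n : nat & L n}) : dcar := exist _ (drel p) (ex_intro _ p erefl).
Definition drep (X : dcar) : {n : nat & L n} :=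
  proj1_sig (constructive_indefinite_description _ (proj2_sig X)).

Definition dadd (X Y : dcar) : dcar :=
  let p := drep X in let q := drep Y in
  dmk (existT L (Nat.add (tag q) (tag p))
         (sadd (up (tag q) (tagged p))
               (eq_rect _ L (up (tag p) (tagged q)) _ (PeanoNat.Nat.add_comm (tag p) (tag q))))).

Definition dspace : space :=
  @Space dcar (dmk (existT L 0%N (szero (L 0))))
    dadd
    (fun X => dmk (existT L (tag (drep X)) (sopp (tagged (drep X)))))
    (fun c X => dmk (existT L (tag (drep X)) (sscale c (tagged (drep X))))).

(* a acts at a level lev a at which it belongs to the subalgebra. *)
Definition dact (a : FA) (X : dcar) : dcar :=
  dmk (existT L (Nat.add (lev a) (tag (drep X))) (uact a (up (lev a) (tagged (drep X))))).

Definition dumod : umod := @UMod dspace dact.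
End DirectLimit.

Definition FAspace : space :=
  @Space FA 0 (fun a b => a + b) (fun a => - a) (fun c a => c *: a).
Definition FAreg : umod := @UMod FAspace (fun a b => a * b).

(* Two-sided ideal generated by the relations (span taken by the quotient). *)
Definition Jrel (x : FA) : Prop := exists a b r, Urel r /\ x = a * r * b.

Definition Uinf : umod := qumod (M := FAreg) Jrel.
Definition proj (a : FA) : Uinf := qmk (M := FAreg) Jrel a.

Definition lgen (S : Uinf -> Prop) (x : Uinf) : Prop :=
  exists a s, S s /\ x = uact a s.

Definition dominant (lam : int -> int) : Prop := forall i, lam (i + 1) <= lam i.

Definition MS (lam : int -> int) (s : Uinf) : Prop :=
  exists i, s = proj (fE i) \/ s = proj (fK i - (qv ^ lam i)%:A).

Definition Mlam (lam : int -> int) : umod := qumod (lgen (MS lam)).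
Definition one_lam (lam : int -> int) : Mlam lam := qmk (lgen (MS lam)) (proj 1).

Definition isFword (w : fmonom gen) : bool := all (fun g : gen => g.1 == tF) w.
Definition FAminus (a : FA) : Prop := span (V := FAspace) (fun b => exists w, isFword w /\ b = << w >>) a.

Definition Fdiv (i : int) (m : nat) : FA := (qfact m)^-1 *: fF i ^+ m.
Definition mexp (lam : int -> int) (i : int) : nat := (absz (lam i - lam (i + 1))%R).+1.

Definition Ilam (lam : int -> int) (x : Mlam lam) : Prop :=
  exists a i, FAminus a /\ x = uact a (uact (Fdiv i (mexp lam i)) (one_lam lam)).

Definition MIlam (lam : int -> int) : umod := qumod (Ilam (lam := lam)).

(* Sum of all proper submodules (= the unique maximal submodule). *)
Definition maxsub (M : umod) (x : M) : Prop :=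
  exists P : M -> Prop, submodule P /\ (exists y, ~ P y) /\ P x.

Definition Llam (lam : int -> int) : umod := qumod (maxsub (M := Mlam lam)).

Definition inrange (n : nat) (g : gen) : bool :=
  if (g.1 == tE) || (g.1 == tF) then (- n%:Z <= g.2) && (g.2 < n%:Z)
  else (- n%:Z <= g.2) && (g.2 <= n%:Z).

Definition FAn (n : nat) (a : FA) : Prop :=
  span (V := FAspace) (fun b => exists w : fmonom gen, all (inrange n) w /\ b = << w >>) a.

Definition Un (n : nat) (u : Uinf) : Prop := exists a, FAn n a /\ u = proj a.
Definition Unmod (n : nat) : umod := sumod (M := Uinf) (Un n).

Definition Sn (lam : int -> int) (n : nat) (s : Uinf) : Prop :=
  exists i,
    ((- n%:Z <= i) && (i < n%:Z) /\ (s = proj (fE i) \/ s = proj (fF i ^+ mexp lam i)))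
 \/ ((- n%:Z <= i) && (i <= n%:Z) /\ s = proj (fK i - (qv ^ lam i)%:A)).

Definition In (lam : int -> int) (n : nat) (x : Unmod n) : Prop :=
  exists a s, FAn n a /\ Sn lam n s /\ proj1_sig x = uact a s.

Definition Ln (lam : int -> int) (n : nat) : umod := qumod (In lam (n := n)).

Definition Un_incl (n : nat) (u : Uinf) : Unmod n.+1 :=
  match excluded_middle_informative (span (Un n.+1) u) with
  | left h => exist (fun x => span (Un n.+1) x) u h
  | right _ => szero (Unmod n.+1)
  end.

Definition Lmap (lam : int -> int) (n : nat) (X : Ln lam n) : Ln lam n.+1 :=
  qmk (In lam (n := n.+1)) (Un_incl n (proj1_sig (qrep X))).

Definition level (a : FA) : nat :=
  match excluded_middle_informative (exists n, FAn n a) with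
  | left h => proj1_sig (constructive_indefinite_description _ h)
  | right _ => 0%N
  end.

Definition Dlim (lam : int -> int) : umod := dumod (Lmap (lam := lam)) level.

(* Main.v *)
(* A nonzero submodule of [M(lam)/I(lam)] contains a weight vector [z <> 0] killed
   by all the [E_i]. The [F_i] act locally nilpotently, so the weight [mu] of [z]
   is dominant. For each finite range [b-n..b] of indices a Casimir operator
     C = sum_j v^(-2j) Y_j,   Y_b = K_b^2,
     Y_j = Y_(j+1) + v^-1 [E_j, [Y_(j+1), F_j]] K_j K_(j+1)^-1
   commutes with the [F_i] of that range and multiplies such a [z] by
   [sum_j v^(2(mu_j - j))]. Comparing with the value at [1_lam] gives [mu = lam],
   because [v] is transcendental and [lam_j - j], [mu_j - j] are strictly
   decreasing; so [z] is a multiple of [1_lam]. Hence [I(lam)] is the maximal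
   submodule. As [I(lam)] is [E]-stable, it is also the union of the [I_n]
   modulo the relations of [M(lam)], so the three modules are quotients of the
   free algebra by the same left ideal. *)
From HB Require Import structures.
From mathcomp Require Import all_boot all_order all_algebra.
From mathcomp Require Import fraction ring_quotient generic_quotient finmap.
From mathcomp.multinomials Require Import monalg.
From mathcomp Require Import ring zify.
From Stdlib Require Import Classical ClassicalEpsilon.
From Stdlib Require Import FunctionalExtensionality PropExtensionality.
Require Import Defs.

Set Implicit Arguments.
Unset Strict Implicit.
Unset Printing Implicit Defensive.
Import Order.TTheory GRing.Theory Num.Theory.
Local Open Scope ring_scope.

(** * Deciding linear identities *)

(** The Casimir sum has no meaning for all of U(infinity), but a given [z] involves finitely many
    [F_i], so a finite range suffices. It yields [mu = lam] on that range only; this is enough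
    because a non-empty word in the [F_i] strictly lowers the weight at its least letter, and [K] at
    that letter separates the word from the top vector. Write X = [Y_(i+1), F_i]. The recursion
    rests on X F_i = v^2 F_i X, which the Serre relation reproduces at each rank. It gives
    [Y_i, F_i] = -v^-2 [Y_(i+1), F_i], while every other Y_j of the range commutes with F_i. Hence
    the coefficients v^(-2j): the two defects cancel. That M(lam) is nonzero is not established
    beforehand, so properness of I(lam) takes the form: if I(lam) is everything, then M(lam) is
    zero. The given modules are bare records without axioms. The linear algebra is done in honest
    quotients of an algebra by left ideals, and transferred by presenting each record as such a
    quotient. *)

Section LinearCombinations.
Variables (k : fieldType) (V : lmodType k).

Inductive lcomb : Type :=
  | LVar of nat | LZero | LAdd of lcomb & lcomb | LOpp of lcomb
  | LScale of k & lcomb.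

Fixpoint lval (env : seq V) (e : lcomb) : V :=
  match e with
  | LVar n => nth 0 env n
  | LZero => 0
  | LAdd e1 e2 => lval env e1 + lval env e2
  | LOpp e1 => - lval env e1
  | LScale c e1 => c *: lval env e1
  end.

Fixpoint lcoef (n : nat) (e : lcomb) : k :=
  match e with
  | LVar m => if eqn m n then 1 else 0
  | LZero => 0
  | LAdd e1 e2 => lcoef n e1 + lcoef n e2
  | LOpp e1 => - lcoef n e1
  | LScale c e1 => c * lcoef n e1
  end.

Fixpoint same_lcoef (m : nat) (e1 e2 : lcomb) : Prop :=
  if m is m'.+1 then lcoef m' e1 = lcoef m' e2 /\ same_lcoef m' e1 e2
  else True.

Lemma lval_coef env e :
  lval env e = \sum_(i < size env) lcoef i e *: nth 0 env i.
Proof.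
elim: e => [n||e1 IH1 e2 IH2|e1 IH1|c e1 IH1] /=.
- case: (ltnP n (size env)) => hn.
    rewrite (bigD1 (Ordinal hn)) //= -[eqn n n]/(n == n) eqxx scale1r.
    rewrite big1 ?addr0 // => i hi; rewrite -[eqn n i]/(n == i).
    by rewrite ifN ?scale0r //; apply: contraNneq hi => hn'; apply/eqP/val_inj.
  rewrite nth_default // big1 // => i _; rewrite -[eqn n i]/(n == i).
  by rewrite ifN ?scale0r //; apply: contraTneq hn => ->; rewrite -ltnNge.
- by rewrite big1 // => i _; rewrite scale0r.
- by rewrite IH1 IH2 -big_split; apply: eq_bigr => i _; rewrite scalerDl.
- by rewrite IH1 -sumrN; apply: eq_bigr => i _; rewrite scaleNr.
- by rewrite IH1 scaler_sumr; apply: eq_bigr => i _; rewrite scalerA.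
Qed.

Lemma same_lcoefP m e1 e2 :
  same_lcoef m e1 e2 -> forall i, (i < m)%N -> lcoef i e1 = lcoef i e2.
Proof.
elim: m => //= m IH [h1 h2] i; rewrite ltnS leq_eqVlt.
by case/orP=> [/eqP->|/IH]; [|apply].
Qed.

(** Treating the atoms as independent reduces an identity of vectors to one scalar equation per
    atom, which [ring] or [field] can close. *)
Lemma lval_eq env e1 e2 :
  same_lcoef (size env) e1 e2 -> lval env e1 = lval env e2.
Proof.
move=> /same_lcoefP h; rewrite !lval_coef.
by apply: eq_bigr => i _; rewrite h.
Qed.

End LinearCombinations.

Ltac lc_index x env :=
  lazymatch env with
  | cons ?y ?env' =>
    match constr:(O) with
    | _ => let _ := match constr:(O) with _ => unify x y end in constr:(O)
    | _ => let n := lc_index x env' in constr:(S n)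
    end
  end.
Ltac lc_insert x env :=
  match constr:(O) with
  | _ => let _ := lc_index x env in env
  | _ => constr:(cons x env)
  end.
Ltac lc_atoms t env :=
  lazymatch t with
  | (?a + ?b)%R => let env1 := lc_atoms a env in lc_atoms b env1
  | (- ?a)%R => lc_atoms a env
  | (?c *: ?a)%R => lc_atoms a env
  | 0%R => env
  | _ => lc_insert t env
  end.
Ltac lc_reify k t env :=
  lazymatch t with
  | (?a + ?b)%R =>
    let x := lc_reify k a env in let y := lc_reify k b env in
    constr:(LAdd x y)
  | (- ?a)%R => let x := lc_reify k a env in constr:(LOpp x)
  | (?c *: ?a)%R => let x := lc_reify k a env in constr:(LScale c x)
  | 0%R => constr:(@LZero k)
  | _ => let n := lc_index t env in constr:(@LVar k n)
  end.
Ltac lc_coefs k V :=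
  lazymatch goal with
  | |- @eq _ ?a ?b =>
    let env0 := lc_atoms a (@nil V) in let env := lc_atoms b env0 in
    let x := lc_reify k a env in let y := lc_reify k b env in
    apply: (@lval_eq k V env x y);
    cbn [same_lcoef lcoef size eqn]; repeat split
  end.

(** * The Casimir recursion *)

Section CasimirStep.
Variables (k : fieldType) (V : lmodType k) (v : k).
Implicit Types (E F Kt Kti Y Z : {linear V -> V}).

Let lin (f : {linear V -> V}) := (linearD f, linearN f, linearZ_LR f).

Definition cas_ext Y E F Kt (x : V) : V :=
  Y x + v^-1 *: (E (Y (F (Kt x)) - F (Y (Kt x)))
                 - (Y (F (E (Kt x))) - F (Y (E (Kt x))))).

Fact cas_ext_linear Y E F Kt : linear (cas_ext Y E F Kt).
Proof.
move=> c x y; rewrite /cas_ext !(lin Y, lin E, lin F, lin Kt).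
by lc_coefs k V; ring.
Qed.
HB.instance Definition _ Y E F Kt :=
  GRing.isLinear.Build k V V _ (cas_ext Y E F Kt) (cas_ext_linear Y E F Kt).


Hypotheses (v0 : v != 0) (vBV0 : v - v^-1 != 0) (vDV0 : v + v^-1 != 0).

Let vv1 : v * v - 1 != 0.
Proof.
by apply: contra_neq vBV0 => h; apply: (mulfI v0); rewrite mulrBr mulfV ?h ?mulr0.
Qed.
Let vv1' : v * v + 1 != 0.
Proof.
by apply: contra_neq vDV0 => h; apply: (mulfI v0); rewrite mulrDr mulfV ?h ?mulr0.
Qed.

Local Ltac lc := lc_coefs k V; (done || field; rewrite ?v0 ?vv1 ?vv1' //; idtac).

(* Only this consequence of the q-commutation of [Y, F] with F survives the
   passage from one rank to the next. *)
Definition qcomm2 Y F := forall x,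
  Y (F (F x)) = (1 + v ^+ 2) *: F (Y (F x)) - v ^+ 2 *: F (F (Y x)).

Definition qserre F F' := forall x,
  F (F (F' x)) - (v + v^-1) *: F (F' (F x)) + F' (F (F x)) = 0.

Lemma qserreE F F' : qserre F F' -> forall x,
  F' (F (F x)) = (v + v^-1) *: F (F' (F x)) - F (F (F' x)).
Proof.
move=> h x; apply/eqP; rewrite -subr_eq0 -(h x); apply/eqP; lc.

Qed.

(** Let R and L be right and left composition with [F]. Since [Kt'] picks up [v] past [F], the Serre
    relation becomes (R - L)(R - v^2 L) = 0 on [F' Kt'], which is the shape of [qcomm2]. On [Z] one
    has R = L, and factors [Z], [E'] commuting with [F] preserve the relation. *)
Lemma cas_ext_qcomm2 Z E' F' Kt' F :
  (forall x, Z (F x) = F (Z x)) -> (forall x, E' (F x) = F (E' x)) ->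
  (forall x, Kt' (F x) = v *: F (Kt' x)) -> qserre F F' ->
  qcomm2 (cas_ext Z E' F' Kt') F.
Proof.
move=> ZF EF KF /qserreE S x.
rewrite /= /cas_ext !(lin Z, lin E', lin F', lin Kt', lin F, ZF, EF, KF, S).
lc.
Qed.

Section SameIndex.
Variables (Y E F Kt Kti : {linear V -> V}).
Hypothesis S : qcomm2 Y F.
Hypothesis EF : forall x,
  E (F x) = F (E x) + (v - v^-1)^-1 *: (Kt x - Kti x).
Hypothesis KtF : forall x, Kt (F x) = v ^- 2 *: F (Kt x).
Hypothesis KtiF : forall x, Kti (F x) = v ^+ 2 *: F (Kti x).
Hypothesis YKt : forall x, Kt (Y x) = Y (Kt x).
Hypothesis YKti : forall x, Kti (Y x) = Y (Kti x).
Hypothesis KtK : forall x, Kti (Kt x) = x.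

(** With X = [Y, F], [qcomm2] reads X F = v^2 F X, so X [Kt] commutes with [F]. The commutator of
    v^-1 [E, X] [Kt] with [F] then only sees [E, F] and equals -(1 + v^-2) X; adding X from [Y]
    itself leaves -v^-2 X. *)
Lemma cas_ext_comm_same x :
  cas_ext Y E F Kt (F x) - F (cas_ext Y E F Kt x)
  = - (v ^- 2 *: (Y (F x) - F (Y x))).
Proof.
rewrite /cas_ext !(lin Y, lin E, lin F, lin Kt, lin Kti,
  EF, KtF, KtiF, YKt, YKti, S, KtK).
lc.
Qed.
End SameIndex.

Section NextIndex.
Variables (Z E F Kt Kti E' F' Kt' Kti' : {linear V -> V}).
Hypothesis S : qcomm2 Z F'.
Hypotheses (ZE : forall x, E (Z x) = Z (E x)) (ZF : forall x, Z (F x) = F (Z x)).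
Hypothesis EF : forall x,
  E (F x) = F (E x) + (v - v^-1)^-1 *: (Kt x - Kti x).
Hypothesis EF' : forall x,
  E' (F' x) = F' (E' x) + (v - v^-1)^-1 *: (Kt' x - Kti' x).
Hypotheses (E'F : forall x, E' (F x) = F (E' x))
  (E_F' : forall x, E (F' x) = F' (E x)).
Hypotheses (ZKt : forall x, Kt (Z x) = Z (Kt x))
  (ZKti : forall x, Kti (Z x) = Z (Kti x))
  (ZKt' : forall x, Kt' (Z x) = Z (Kt' x))
  (ZKti' : forall x, Kti' (Z x) = Z (Kti' x)).
Hypotheses (KtF' : forall x, Kt (F' x) = v *: F' (Kt x))
  (KtiF' : forall x, Kti (F' x) = v^-1 *: F' (Kti x))
  (Kt'F : forall x, Kt' (F x) = v *: F (Kt' x))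
  (Kti'F : forall x, Kti' (F x) = v^-1 *: F (Kti' x))
  (Kt'F' : forall x, Kt' (F' x) = v ^- 2 *: F' (Kt' x))
  (Kti'F' : forall x, Kti' (F' x) = v ^+ 2 *: F' (Kti' x)).
Hypothesis KtK : forall x, Kti (Kt x) = x.
Hypothesis Kt'K : forall x, Kti' (Kt' x) = x.
Hypothesis serre : qserre F' F.

Let LL := (lin Z, lin E, lin F, lin Kt, lin Kti,
  lin E', lin F', lin Kt', lin Kti').

Let X' x := Z (F' x) - F' (Z x).
(** The q-commutator of [Z, F'] with [F]. By [XE] it determines [Y, F] as v^-1 [E', H] [Kt'], and
    its commutation with [F'], [E] and the K's closes up. *)
Let H x := v *: X' (F x) - F (X' x).
Let Y := cas_ext Z E' F' Kt'.
Let X x := Y (F x) - F (Y x).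

(* F'F'F - (v + v^-1) F'FF' + FF'F' = 0 commuted with Z. *)
Let H_F' x : H (F' x) = v *: F' (H x).
Proof.
(* [qcomm2] says nothing about [Z] before the mixed word F' F F'. The Serre relation, divided by v +
   v^-1, expresses it through words where the two F' are adjacent. *)
have ZS : Z (F' (F (F' x)))
    = (v + v^-1)^-1 *: (F (Z (F' (F' x))) + Z (F' (F' (F x)))).
  have /(congr1 Z) := serre x; rewrite !(lin Z) linear0 !ZF => h.
  apply: (@scalerI _ _ (v + v^-1)) => //.
  rewrite scalerA mulfV // scale1r; apply/eqP; rewrite -subr_eq0.
  rewrite -oppr_eq0 -h; apply/eqP; lc.
rewrite /H /X' !LL ZS !S !(LL, ZF) !(qserreE serre).
lc.
Qed.

Let XE x : X x = v^-1 *: (E' (H (Kt' x)) - H (E' (Kt' x))).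
Proof.
rewrite /X /Y /= /cas_ext /H /X' !(LL, ZF, E'F, Kt'F).
lc.
Qed.

Let linH (c : k) x y : (H (x + y) = H x + H y) * (H (- x) = - H x)
   * (H (c *: x) = c *: H x).
Proof. by rewrite /H /X' !LL; split; [split|]; lc. Qed.

Let HD x y : H (x + y) = H x + H y. Proof. by rewrite linH. Qed.
Let HN x : H (- x) = - H x. Proof. by rewrite (linH 0 x 0). Qed.
Let HZ c x : H (c *: x) = c *: H x. Proof. by rewrite (linH c x 0). Qed.

Let Kt'H x : Kt' (H x) = v^-1 *: H (Kt' x).
Proof. rewrite /H /X' !(LL, ZKt', Kt'F, Kt'F'); lc. Qed.

Let Kti'H x : Kti' (H x) = v *: H (Kti' x).
Proof. rewrite /H /X' !(LL, ZKti', Kti'F, Kti'F'); lc. Qed.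

Let XF' x : v *: X (F' x) - F' (X x) = - (v^-1 *: H x).
Proof.
rewrite !XE; clearbody H.
rewrite !(LL, Kt'F', EF', HD, HN, HZ, H_F', Kt'H, Kti'H, Kt'K).
lc.
Qed.

Let EH x : E (H x) - H (E x) = - X' (Kti x).
Proof.
rewrite /H /X' !(LL, ZE, EF, E_F', ZF, ZKt, ZKti, KtF', KtiF').
lc.
Qed.

(** Moving F' across leaves two defects. The summand [Y] gives -v^-2 X'. In v^-1 [E, X] [Kt] the
    q-commutator of X with F' is a multiple of [H], and [E, H] = -X' [Kti] turns it into +v^-2
    X'. *)
Lemma cas_ext_comm_next x :
  cas_ext Y E F Kt (F' x) = F' (cas_ext Y E F Kt x).
Proof.
have YF' y : Y (F' y) = F' (Y y) - v ^- 2 *: X' y.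
  have := cas_ext_comm_same S EF' Kt'F' Kti'F' ZKt' ZKti' Kt'K y.
  by rewrite -/(X' y) -/Y => h; rewrite -h addrC subrK.
have XF y : X (F' y) = v^-1 *: F' (X y) - v ^- 2 *: H y.
  apply: (@scalerI _ _ v) => //; apply/eqP; rewrite -subr_eq0.
  move: (XF' y) => h.
  rewrite -[v *: _](subrK (F' (X y))) h; apply/eqP; lc.
have extE y : cas_ext Y E F Kt y
    = Y y + v^-1 *: (E (X (Kt y)) - X (E (Kt y))) by [].
have EHE y : E (H y) = H (E y) - X' (Kti y).
  by rewrite -EH addrC subrK.
rewrite !extE YF' KtF'.
have YZ c y : Y (c *: y) = c *: Y y by exact: linearZ_LR.
have XZ c y : X (c *: y) = c *: X y by rewrite /X !(LL, YZ); clearbody Y; lc.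
move: XF XZ EHE YF' => {extE}; clearbody X H; move: (X') (Y) => X1 Y1 XF XZ EHE YF'.
rewrite !(LL, E_F', XZ, XF, EHE, KtK).
lc.
Qed.

End NextIndex.

(** The scalars on [E] and [F] are inverse and each occurs once in the bracket. Powers of [v] for
    [c] will give commutation with the K's, and [c = 1] commutation with [E] and [F] of distant
    index. *)
Lemma cas_ext_commute Y E F Kt (D : {linear V -> V}) (c : k) :
  c != 0 -> (forall x, D (Y x) = Y (D x)) ->
  (forall x, D (E x) = c *: E (D x)) -> (forall x, D (F x) = c^-1 *: F (D x)) ->
  (forall x, D (Kt x) = Kt (D x)) ->
  forall x, D (cas_ext Y E F Kt x) = cas_ext Y E F Kt (D x).
Proof.
move=> c0 DY DE DF DK x; rewrite /cas_ext.
rewrite !(lin D, lin Y, lin E, lin F, DY, DE, DF, DK).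
by lc_coefs k V; field; rewrite ?v0 ?c0.
Qed.

(** Here [n] and [m] are the weights at i and i + 1. The added term is v^-1 (v^(2m+2) - v^(2m))
    [n-m] v^(n-m) = v^(2m) (v^(2(n-m)) - 1), which accounts for the factor v^-1 in [cas_ext]. *)
Lemma cas_ext_singular Y E F Kt (m n : int) y :
  Kt y = v ^ (n - m) *: y -> E y = 0 ->
  E (F y) = (v - v^-1)^-1 *: ((v ^ (n - m) - v ^ (m - n)) *: y) ->
  Y y = v ^ (m + m) *: y -> Y (F y) = v ^ (m + 1 + (m + 1)) *: F y ->
  cas_ext Y E F Kt y = v ^ (n + n) *: y.
Proof.
move=> Ky Ey EFy Yy YFy; rewrite /cas_ext.
rewrite !(lin Y, lin E, lin F, Ky, Ey, EFy, Yy, YFy) !linear0.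
rewrite !(expfzDr, expr1z, exprN1, =^~ invr_expz) //.
have := expfz_neq0 n v0; have := expfz_neq0 m v0.
move: (v ^ n) (v ^ m) => a b b0 a0.
lc_coefs k V; field; rewrite ?v0 ?vv1 ?b0 ?a0 //.
Qed.

End CasimirStep.

(** The i-th coordinate of the weight of [F_j], the negative of a simple root. *)
Definition kwt (i j : int) : int := dlt i (j + 1) - dlt i j.

Lemma kwt0 i j : i != j -> i != j + 1 -> kwt i j = 0.
Proof. by rewrite /kwt /dlt => /negbTE-> /negbTE->. Qed.

Lemma kwt_same i : kwt i i = -1.
Proof. by rewrite /kwt /dlt eqxx; case: eqP => //; lia. Qed.
Lemma kwt_next i : kwt (i + 1) i = 1.
Proof. by rewrite /kwt /dlt eqxx; case: eqP => //; lia. Qed.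

Lemma kwt_prev i : kwt i (i + 1) = 0.
Proof. by rewrite kwt0 //; lia. Qed.
Lemma kwt_next2 i : kwt (i + 1 + 1) i = 0.
Proof. by rewrite kwt0 //; lia. Qed.

(** * Modules over the defining relations, and their weights *)

Section Representation.
Variables (k : fieldType) (v : k) (V : lmodType k).

Record uinf_rep := UinfRep {
  rE : int -> {linear V -> V};
  rF : int -> {linear V -> V};
  rK : int -> {linear V -> V};
  rKi : int -> {linear V -> V};
  rKK : forall i j x, rK i (rK j x) = rK j (rK i x);
  rKKi : forall i x, rK i (rKi i x) = x;
  rKiK : forall i x, rKi i (rK i x) = x;
  rKE : forall i j x, rK i (rE j x) = v ^ (- kwt i j) *: rE j (rK i x);
  rKF : forall i j x, rK i (rF j x) = v ^ kwt i j *: rF j (rK i x);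
  rFF : forall i j x, 1 < `|i - j| -> rF i (rF j x) = rF j (rF i x);
  rEE : forall i j x, 1 < `|i - j| -> rE i (rE j x) = rE j (rE i x);
  rEF : forall i j x, rE i (rF j x) = rF j (rE i x) + (dlt i j)%:~R *:
     ((v - v^-1)^-1 *: (rK i (rKi (i + 1) x) - rKi i (rK (i + 1) x)));
  rserreF : forall i j, `|i - j| = 1 -> qserre v (rF i) (rF j) }.

Variable R : uinf_rep.
Hypothesis vinj : forall m n : int, v ^ m = v ^ n -> m = n.
Hypothesis v0 : v != 0.

Lemma vBV_neq0 : v - v^-1 != 0.
Proof.
rewrite subr_eq0; apply/eqP => h.
by have /vinj : v ^ 1 = v ^ (-1) by rewrite expr1z exprN1.
Qed.

Lemma vDV_neq0 : v + v^-1 != 0.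
Proof.
apply/eqP => h; have vv : v * v = -1.
  apply/eqP; rewrite -subr_eq0 opprK; apply/eqP.
  by rewrite -(mulr0 v) -h mulrDr mulfV.
have /vinj // : v ^ 4 = v ^ 0.
by rewrite expr0z -exprnP -[v ^+ 4]/(v * (v * (v * v))) vv mulrN1 mulrN vv opprK.
Qed.

Local Notation E := (rE R).
Local Notation F := (rF R).
Local Notation K := (rK R).
Local Notation Ki := (rKi R).

Lemma rK_inj i : injective (K i).
Proof. by move=> x y /(congr1 (Ki i)); rewrite !rKiK. Qed.

Lemma rKi_comm (T : {linear V -> V}) (c : k) i : c != 0 ->
  (forall x, K i (T x) = c *: T (K i x)) ->
  forall x, Ki i (T x) = c^-1 *: T (Ki i x).
Proof.
move=> c0 KT x; apply: (@rK_inj i).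
by rewrite rKKi linearZ_LR KT rKKi scalerA mulVf // scale1r.
Qed.

Lemma rKiF i j x : Ki i (F j x) = v ^ (- kwt i j) *: F j (Ki i x).
Proof.
rewrite (rKi_comm (expfz_neq0 _ v0) (rKF R i j)).
by rewrite invr_expz.
Qed.

Lemma rKiE i j x : Ki i (E j x) = v ^ kwt i j *: E j (Ki i x).
Proof.
rewrite (rKi_comm (expfz_neq0 _ v0) (rKE R i j)).
by rewrite invr_expz opprK.
Qed.

Lemma rKiKc i j x : Ki i (K j x) = K j (Ki i x).
Proof. by apply: (@rK_inj i); rewrite rKK !rKKi. Qed.

Definition rKt i : {linear V -> V} := (K i \o Ki (i + 1))%FUN.
Definition rKti i : {linear V -> V} := (Ki i \o K (i + 1))%FUN.
Local Notation Kt := rKt.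
Local Notation Kti := rKti.

Lemma rKtK i x : Kti i (Kt i x) = x.
Proof. by rewrite /= rKK rKKi rKiK. Qed.

Lemma rEF_same i x :
  E i (F i x) = F i (E i x) + (v - v^-1)^-1 *: (Kt i x - Kti i x).
Proof. by rewrite rEF /dlt eqxx scale1r. Qed.

Lemma rEF_diff i j x : i != j -> E i (F j x) = F j (E i x).
Proof. by move=> /negbTE ij; rewrite rEF /dlt ij scale0r addr0. Qed.

Lemma rKtF i j x :
  Kt i (F j x) = v ^ (kwt i j - kwt (i + 1) j) *: F j (Kt i x).
Proof.
rewrite /= rKiF linearZ_LR rKF scalerA; congr (_ *: _).
by rewrite expfzDr // mulrC.
Qed.

Lemma rKtiF i j x :
  Kti i (F j x) = v ^ (kwt (i + 1) j - kwt i j) *: F j (Kti i x).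
Proof.
rewrite /= rKF linearZ_LR rKiF scalerA; congr (_ *: _).
by rewrite expfzDr // mulrC.
Qed.

Definition is_wt (mu : int -> int) x := forall i, K i x = v ^ mu i *: x.

Lemma wt_Ki mu x : is_wt mu x -> forall i, Ki i x = v ^ (- mu i) *: x.
Proof.
move=> h i; apply: (@rK_inj i); rewrite rKKi linearZ_LR h scalerA -expfzDr //.
by rewrite addNr expr0z scale1r.
Qed.

Lemma wt_Kt mu x : is_wt mu x -> forall i, Kt i x = v ^ (mu i - mu (i + 1)) *: x.
Proof.
move=> h i; rewrite /= (wt_Ki h) linearZ_LR h scalerA -expfzDr //.
by rewrite addrC.
Qed.

Lemma wt_Kti mu x : is_wt mu x ->
  forall i, Kti i x = v ^ (mu (i + 1) - mu i) *: x.
Proof.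
move=> h i; rewrite /= h linearZ_LR (wt_Ki h) scalerA -expfzDr //.
Qed.

Lemma wt_F mu x j : is_wt mu x -> is_wt (fun i => mu i + kwt i j) (F j x).
Proof.
by move=> h i; rewrite rKF h linearZ_LR scalerA -expfzDr // addrC.
Qed.

Lemma wt_E mu x j : is_wt mu x -> is_wt (fun i => mu i - kwt i j) (E j x).
Proof.
by move=> h i; rewrite rKE h linearZ_LR scalerA -expfzDr // addrC.
Qed.

(** * The Casimir operator of a finite range of indices *)

Section Casimir.
Variable b : int.

(** Steps go downwards from [b]: [cas_term j] is the Y_(b-j) of the overview, and the coefficient
    v^(-2j) there becomes v^(2j) in [casimir], up to a constant factor. *)
Definition cidx (j : nat) : int := b - 1 - j%:Z.

Fixpoint cas_term (j : nat) : {linear V -> V} :=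
  if j is j'.+1 then
    cas_ext v (cas_term j') (E (cidx j')) (F (cidx j')) (Kt (cidx j'))
  else (K b \o K b)%FUN.

Lemma cas_term_commute (D : {linear V -> V}) (c : int -> k) j :
  (forall i, c i != 0) ->
  (forall x, D (K b x) = K b (D x)) ->
  (forall i x, (i < j)%N -> D (E (cidx i) x) = c (cidx i) *: E (cidx i) (D x)) ->
  (forall i x, (i < j)%N ->
     D (F (cidx i) x) = (c (cidx i))^-1 *: F (cidx i) (D x)) ->
  (forall i x, (i < j)%N -> D (Kt (cidx i) x) = Kt (cidx i) (D x)) ->
  forall x, D (cas_term j x) = cas_term j (D x).
Proof.
move=> c0 DK; elim: j => [|j IH] DE DF DKt x; first by rewrite /= !DK.
have IHx := IH (fun i x h => DE i x (ltnW h)) (fun i x h => DF i x (ltnW h))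
  (fun i x h => DKt i x (ltnW h)).
exact: (cas_ext_commute v0 (c0 (cidx j)) IHx (fun x => DE j x (ltnSn j))
  (fun x => DF j x (ltnSn j)) (fun x => DKt j x (ltnSn j))).
Qed.

Lemma cas_term_K i j x : K i (cas_term j x) = cas_term j (K i x).
Proof.
apply: (@cas_term_commute _ (fun l => v ^ (- kwt i l))) => //.
- by move=> l; apply: expfz_neq0.
- by move=> y; rewrite rKK.
- by move=> l y _; rewrite rKE.
- by move=> l y _; rewrite rKF invr_expz opprK.
- by move=> l y _ /=; rewrite rKK rKiKc.
Qed.

Lemma cas_term_Ki i j x : Ki i (cas_term j x) = cas_term j (Ki i x).
Proof. by apply: (@rK_inj i); rewrite cas_term_K !rKKi. Qed.

Lemma cas_term_Kt i j x : Kt i (cas_term j x) = cas_term j (Kt i x).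
Proof. by rewrite /= cas_term_Ki cas_term_K. Qed.

Lemma cas_term_Kti i j x : Kti i (cas_term j x) = cas_term j (Kti i x).
Proof. by rewrite /= cas_term_K cas_term_Ki. Qed.

Lemma cas_term_F_far i j x : (j < i)%N ->
  F (cidx i) (cas_term j x) = cas_term j (F (cidx i) x).
Proof.
move=> ji; apply: (@cas_term_commute _ (fun => 1)) => //.
- by move=> *; apply: oner_neq0.
- by move=> y; rewrite rKF kwt0 ?expr0z ?scale1r // /cidx; lia.
- by move=> l y lj; rewrite scale1r rEF_diff // /cidx; lia.
- by move=> l y lj; rewrite invr1 scale1r rFF // /cidx; lia.
- move=> l y lj; rewrite rKtF !kwt0 ?subr0 ?expr0z ?scale1r // /cidx; lia.
Qed.

Lemma cas_term_E_far i j x : (j < i)%N ->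
  E (cidx i) (cas_term j x) = cas_term j (E (cidx i) x).
Proof.
move=> ji; apply: (@cas_term_commute _ (fun => 1)) => //.
- by move=> *; apply: oner_neq0.
- by move=> y; rewrite rKE kwt0 ?oppr0 ?expr0z ?scale1r // /cidx; lia.
- by move=> l y lj; rewrite scale1r rEE // /cidx; lia.
- by move=> l y lj; rewrite invr1 scale1r rEF_diff // /cidx; lia.
- move=> l y lj; rewrite /= rKiE linearZ_LR rKE scalerA.
  by rewrite !kwt0 ?oppr0 ?expr0z ?mulr1 ?scale1r // /cidx; lia.
Qed.

Lemma cidxS j : cidx j.+1 = cidx j - 1.
Proof. by rewrite /cidx; lia. Qed.

(** At the start K_b^2 simply picks up v^2 past F_(b-1). Afterwards [cas_term j] commutes with
    [F (cidx j.+1)], whose index is at distance at least two from those it contains, and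
    [cas_ext_qcomm2] applies. *)
Lemma cas_term_qcomm2 j : qcomm2 v (cas_term j) (F (cidx j)).
Proof.
case: j => [|j] x.
  have cE y : cas_term 0 y = K b (K b y) by [].
  rewrite !cE {cE}.
  rewrite (_ : cidx 0 = b - 1) /cidx ?subr0 //.
  have KF y : K b (F (b - 1) y) = v *: F (b - 1) (K b y).
    by rewrite rKF -{1}[b](subrK 1) kwt_next expr1z.
  rewrite !(KF, linearZ_LR (F (b - 1)), linearZ_LR (K b)).
  by lc_coefs k V; ring.
have KtF y : Kt (cidx j) (F (cidx j.+1) y)
    = v *: F (cidx j.+1) (Kt (cidx j) y).
  rewrite rKtF -[v in RHS]expr1z; congr (v ^ _ *: _).
  by rewrite /kwt /dlt /cidx; do ![case: eqP => ?]; lia.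
have EF y : E (cidx j) (F (cidx j.+1) y) = F (cidx j.+1) (E (cidx j) y).
  by rewrite rEF_diff // /cidx; lia.
have S : `|cidx j.+1 - cidx j| = 1 by rewrite /cidx; lia.
exact: (cas_ext_qcomm2 v0
  (fun y => esym (@cas_term_F_far j.+1 j y (ltnSn j))) EF KtF (rserreF R S)).
Qed.

Lemma rKtF_same i x : Kt i (F i x) = v ^- 2 *: F i (Kt i x).
Proof. by rewrite rKtF kwt_same kwt_next. Qed.
Lemma rKtiF_same i x : Kti i (F i x) = v ^+ 2 *: F i (Kti i x).
Proof. by rewrite rKtiF kwt_same kwt_next. Qed.

Lemma cas_termS_F j x :
  cas_term j.+1 (F (cidx j) x) - F (cidx j) (cas_term j.+1 x)
  = - (v ^- 2 *: (cas_term j (F (cidx j) x) - F (cidx j) (cas_term j x))).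
Proof.
exact: (cas_ext_comm_same v0 vBV_neq0 (cas_term_qcomm2 j) (rEF_same _)
  (rKtF_same _) (rKtiF_same _) (cas_term_Kt _ j) (cas_term_Kti _ j) (rKtK _)).
Qed.

Lemma cas_termSS_F j x :
  cas_term j.+2 (F (cidx j) x) = F (cidx j) (cas_term j.+2 x).
Proof.
have cE : cidx j = cidx j.+1 + 1 by rewrite cidxS subrK.
have jj := ltnSn j.
have ne : cidx j != cidx j.+1 by rewrite /cidx; lia.
have ne' : cidx j.+1 != cidx j by rewrite /cidx; lia.
have S : `|cidx j - cidx j.+1| = 1 by rewrite /cidx; lia.
have KtF' y : Kt (cidx j.+1) (F (cidx j) y) = v *: F (cidx j) (Kt (cidx j.+1) y).
  by rewrite rKtF cE kwt_prev kwt_same sub0r opprK expr1z.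
have KtiF' y :
    Kti (cidx j.+1) (F (cidx j) y) = v^-1 *: F (cidx j) (Kti (cidx j.+1) y).
  by rewrite rKtiF cE kwt_prev kwt_same subr0 exprN1.
have Kt'F y : Kt (cidx j) (F (cidx j.+1) y) = v *: F (cidx j.+1) (Kt (cidx j) y).
  by rewrite rKtF cE kwt_next kwt_next2 subr0 expr1z.
have Kti'F y :
    Kti (cidx j) (F (cidx j.+1) y) = v^-1 *: F (cidx j.+1) (Kti (cidx j) y).
  by rewrite rKtiF cE kwt_next kwt_next2 sub0r exprN1.
have h := (cas_ext_comm_next v0 vBV_neq0 vDV_neq0 (cas_term_qcomm2 j)
  (fun y => cas_term_E_far y jj) (fun y => esym (cas_term_F_far y jj))
  (rEF_same _) (rEF_same _) (fun y => rEF_diff y ne) (fun y => rEF_diff y ne')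
  (cas_term_Kt _ j) (cas_term_Kti _ j) (cas_term_Kt _ j) (cas_term_Kti _ j)
  KtF' KtiF' Kt'F Kti'F (rKtF_same _)
  (rKtiF_same _) (rKtK _) (rKtK _) (rserreF R S)).
exact: (h x).
Qed.

(** Commutation holds at step [j.+2], and all further steps use indices at distance at least two
    from [cidx j]. *)
Lemma cas_term_F_near i j x : (j.+1 < i)%N ->
  cas_term i (F (cidx j) x) = F (cidx j) (cas_term i x).
Proof.
elim: i x => // i IH x; rewrite ltnS leq_eqVlt => /orP[/eqP<-|ji].
  exact: cas_termSS_F.
apply/esym; apply: (cas_ext_commute v0 (oner_neq0 _)) => [y|y|y|y].
- by rewrite IH.
- by rewrite scale1r rEF_diff // /cidx; lia.
- by rewrite invr1 scale1r rFF // /cidx; lia.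
- by rewrite rKtF !kwt0 ?subr0 ?expr0z ?scale1r // /cidx; lia.
Qed.

Definition casimir n x := \sum_(j < n.+1) v ^+ (j + j) *: cas_term j x.

(** Only the terms of index [j] and [j.+1] fail to commute with this [F]. Their defects have ratio
    -v^-2 and their coefficients ratio v^2. *)
Lemma casimir_F n j x : (j < n)%N ->
  casimir n (F (cidx j) x) = F (cidx j) (casimir n x).
Proof.
move=> jn; apply/eqP; rewrite -subr_eq0 /casimir raddf_sum -sumrB.
have E1 (i : 'I_n.+1) : true -> v ^+ (i + i) *: cas_term i (F (cidx j) x) -
    F (cidx j) (v ^+ (i + i) *: cas_term i x)
  = v ^+ (i + i) *: (cas_term i (F (cidx j) x) - F (cidx j) (cas_term i x)).
  by rewrite linearZ_LR scalerBr.
rewrite (eq_bigr _ E1).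
have jn1 : (j < n.+1)%N by apply: ltnW.
rewrite (bigD1 (Ordinal jn1)) //= (bigD1 (Ordinal (jn : j.+1 < n.+1)%N)) /=; last first.
  by rewrite -val_eqE /=; lia.
rewrite big1 => [|i]; last first.
  rewrite -!val_eqE /= => /andP[h1 h2].
  case: (ltngtP i j) => hij; last by rewrite hij eqxx in h1.
    by rewrite cas_term_F_far // subrr scaler0.
  by rewrite cas_term_F_near ?subrr ?scaler0 //; lia.
rewrite addr0 (cas_termS_F j x); apply/eqP.
set X := _ - _; rewrite !addnS addSn !exprS.
by lc_coefs k V; field.
Qed.

(** The recursion also needs the eigenvalue of the previous term on [F (cidx j) y]. That vector is
    still killed by the [E (cidx i)] with [i < j], and its weight at b - j is larger by one; so the
    induction keeps [mu] and [y] general and restricts the vanishing to these [E]. *)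
Lemma cas_term_singular j mu y : is_wt mu y ->
  (forall i, (i < j)%N -> E (cidx i) y = 0) ->
  cas_term j y = v ^ (mu (b - j%:Z) + mu (b - j%:Z)) *: y.
Proof.
elim: j mu y => [|j IH] mu y wy Ey.
  by rewrite /= !wy linearZ_LR wy scalerA -expfzDr // subr0.
have cE : cidx j = b - j.+1%:Z by rewrite /cidx; lia.
have cE1 : cidx j + 1 = b - j%:Z by rewrite /cidx; lia.
rewrite -cE.
apply: (cas_ext_singular v0 vBV_neq0 (m := mu (b - j%:Z))).
- by rewrite (wt_Kt wy) cE1.
- exact: Ey.
- rewrite rEF_same Ey // linear0 add0r (wt_Kt wy) (wt_Kti wy) cE1.
  by rewrite scalerBl.
- by apply: IH => // i ij; apply: Ey; apply: ltnW.
- have := IH _ _ (wt_F (cidx j) wy); rewrite -cE1 kwt_next; apply=> i ij.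
  rewrite rEF_diff; last by rewrite /cidx; lia.
  by rewrite Ey ?linear0 // ltnW.
Qed.

Lemma casimir_singular n mu y : is_wt mu y ->
  (forall i, E i y = 0) ->
  casimir n y = (\sum_(j < n.+1) v ^ (2 * (mu (b - j%:Z) + j%:Z))) *: y.
Proof.
move=> wy Ey; rewrite /casimir scaler_suml; apply: eq_bigr => j _.
rewrite (cas_term_singular wy) // scalerA exprnP -expfzDr //.
by congr (v ^ _ *: _); lia.
Qed.

End Casimir.
End Representation.

(** * Highest weight vectors *)

Section LinearSpan.
Variables (k : fieldType) (V : lmodType k).
Implicit Types (P S : V -> Prop).

Definition lin_closed S :=
  S 0 /\ forall c x y, S x -> S y -> S (c *: x + y).

Inductive lspan P x : Prop :=
  LSpan of forall S, lin_closed S -> (forall y, P y -> S y) -> S x.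

Lemma lspan_min P S : lin_closed S -> (forall y, P y -> S y) ->
  forall x, lspan P x -> S x.
Proof. by move=> hS PS x []; apply. Qed.

Lemma lin_closedD S x y : lin_closed S -> S x -> S y -> S (x + y).
Proof. by case=> _ h hx hy; rewrite -[x]scale1r; apply: h. Qed.
Lemma lin_closedZ S c x : lin_closed S -> S x -> S (c *: x).
Proof. by case=> h0 h hx; rewrite -[_ *: x]addr0; apply: h. Qed.
Lemma lin_closedB S x y : lin_closed S -> S x -> S y -> S (x - y).
Proof.
by move=> h hx hy; apply: lin_closedD => //; rewrite -scaleN1r; apply: lin_closedZ.
Qed.
Lemma lin_closed_sum S (I : Type) (r : seq I) (f : I -> V) : lin_closed S ->
  (forall i, S (f i)) -> S (\sum_(i <- r) f i).
Proof.
move=> h hf; elim: r => [|i r IH]; rewrite ?big_nil ?big_cons; first by case: h.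
exact: lin_closedD.
Qed.

Lemma lin_closed_span P : lin_closed (lspan P).
Proof.
split=> [|c x y hx hy]; first by split=> S [].
by split=> S hS PS; case: (hS) => _; apply; [move: hx|move: hy]; apply: lspan_min.
Qed.

Lemma lspan_mem P x : P x -> lspan P x.
Proof. by move=> Px; split=> S _; apply. Qed.

Lemma lin_closed_preim S (f : {linear V -> V}) :
  lin_closed S -> lin_closed (fun x => S (f x)).
Proof. by case=> S0 Sl; split=> [|c x y]; rewrite ?linear0 // linearP; apply: Sl. Qed.

Lemma lspan_sub P Q : (forall x, P x -> lspan Q x) -> forall x, lspan P x -> lspan Q x.
Proof. by move=> h; apply: lspan_min => //; apply: lin_closed_span. Qed.

Lemma lspan_image P Q (f : {linear V -> V}) :
  (forall x, P x -> lspan Q (f x)) -> forall x, lspan P x -> lspan Q (f x).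
Proof.
move=> h; apply: lspan_min => //.
exact/lin_closed_preim/lin_closed_span.
Qed.

End LinearSpan.

Section HighestWeight.
Variables (k : fieldType) (v : k) (V : lmodType k) (R : uinf_rep v V).
Hypothesis vinj : forall m n : int, v ^ m = v ^ n -> m = n.
Hypothesis v0 : v != 0.

Local Notation E := (rE R).
Local Notation F := (rF R).
Local Notation K := (rK R).
Local Notation Ki := (rKi R).

Definition is_hw lam z := (forall i, E i z = 0) /\ is_wt R lam z.

Definition Fword (z : V) (s : seq int) : V := foldr (fun i x => F i x) z s.

Definition word_wt (lam : int -> int) (s : seq int) (i : int) : int :=
  lam i + \sum_(j <- s) kwt i j.

Lemma wt_Fword lam z s : is_wt R lam z -> is_wt R (word_wt lam s) (Fword z s).
Proof.
move=> wz; elim: s => [|j s IH] i /=; first by rewrite /word_wt big_nil addr0.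
rewrite (wt_F v0 j IH) /word_wt big_cons; congr (v ^ _ *: _).
by rewrite -addrA; congr (_ + _); rewrite addrC.
Qed.

Definition word_span z (A : pred (seq int)) :=
  lspan (fun x => exists2 s, A s & x = Fword z s).

Lemma word_span_closed z A : lin_closed (word_span z A).
Proof. exact: lin_closed_span. Qed.

Lemma word_span_mem z (A : pred (seq int)) s : A s -> word_span z A (Fword z s).
Proof. by move=> As; apply: lspan_mem; exists s. Qed.

Lemma word_span_sub z (A B : pred (seq int)) : (forall s, A s -> B s) ->
  forall x, word_span z A x -> word_span z B x.
Proof.
move=> AB; apply: lspan_sub => x [s As ->].
exact: (@word_span_mem z B s (AB s As)).
Qed.

Lemma word_span_F z (A B : pred (seq int)) j :
  (forall s, A s -> B (j :: s)) -> forall x, word_span z A x -> word_span z B (F j x).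
Proof.
move=> AB; apply: lspan_image => x [s As ->].
by apply: (@word_span_mem _ _ (j :: s)); apply: AB.
Qed.

Lemma word_span_K z lam A i x : is_wt R lam z -> word_span z A x ->
  word_span z A (K i x).
Proof.
move=> wz; move: x; apply: lspan_image => x [s As ->].
rewrite (wt_Fword s wz); apply: (lin_closedZ _ (@word_span_closed z A)).
exact: word_span_mem.
Qed.

Lemma word_span_Ki z lam A i x : is_wt R lam z -> word_span z A x ->
  word_span z A (Ki i x).
Proof.
move=> wz; move: x; apply: lspan_image => x [s As ->].
rewrite (wt_Ki v0 (wt_Fword s wz)); apply: (lin_closedZ _ (@word_span_closed z A)).
exact: word_span_mem.
Qed.

Definition shorter (d : nat) : pred (seq int) := fun s => (size s < d)%N.

(** Moving [E i] to the right either deletes a letter, at the cost of a weight scalar, or reaches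
    [z] and gives zero. *)
Lemma hw_E_Fword lam z i s : is_hw lam z ->
  word_span z (shorter (size s)) (E i (Fword z s)).
Proof.
move=> [Ez wz]; elim: s => [|j s IH] /=.
  by rewrite Ez; case: (@word_span_closed z (shorter 0)).
have cl := @word_span_closed z (shorter (size s).+1).
rewrite rEF; apply: (lin_closedD cl).
  by apply: word_span_F IH => t; rewrite /shorter /= ltnS.
do 2!apply: (lin_closedZ _ cl).
have ws := wt_Fword s wz.
have -> : K i (Ki (i + 1) (Fword z s)) = rKt R i (Fword z s) by [].
have -> : Ki i (K (i + 1) (Fword z s)) = rKti R i (Fword z s) by [].
rewrite (wt_Kt v0 ws) (wt_Kti v0 ws).
by apply: (lin_closedB cl); apply: (lin_closedZ _ cl); apply: word_span_mem;
  rewrite /shorter /=.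
Qed.

Lemma hw_span_E lam z i d x : is_hw lam z ->
  word_span z (shorter d.+1) x -> word_span z (shorter d) (E i x).
Proof.
move=> hz; move: x; apply: lspan_image => x [s sd ->].
apply: (@word_span_sub z (shorter (size s)) (shorter d) _ _ (hw_E_Fword i s hz)).
by move=> t h; apply: (leq_trans h).
Qed.

Lemma hw_spanT_E lam z i x : is_hw lam z ->
  word_span z predT x -> word_span z predT (E i x).
Proof.
move=> hz; move: x; apply: lspan_image => x [s sd ->].
exact: (@word_span_sub z _ predT (fun _ _ => isT) _ (hw_E_Fword i s hz)).
Qed.

Lemma word_span_shorter z x : word_span z predT x ->
  exists d, word_span z (shorter d) x.
Proof.
move: x; apply: lspan_min => [|y [s _ ->]]; last first.
  by exists (size s).+1; apply: word_span_mem; rewrite /shorter.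
split=> [|c x1 x2 [d1 h1] [d2 h2]].
  by exists 0%N; case: (@word_span_closed z (shorter 0)).
exists (maxn d1 d2); case: (@word_span_closed z (shorter (maxn d1 d2))) => _; apply.
  by apply: word_span_sub h1 => s; rewrite /shorter leq_max => ->.
by apply: word_span_sub h2 => s; rewrite /shorter leq_max => ->; rewrite orbT.
Qed.

Definition letters_in (n : nat) : pred (seq int) :=
  all (fun i : int => (- n%:Z <= i) && (i < n%:Z)).

Lemma word_span_letters z x : word_span z predT x ->
  exists n, word_span z (letters_in n) x.
Proof.
have mono m n : (m <= n)%N -> forall s, letters_in m s -> letters_in n s.
  by move=> mn s; apply: sub_all => i; lia.
move: x; apply: lspan_min => [|y [s _ ->]].
  split=> [|c x1 x2 [d1 h1] [d2 h2]].
    by exists 0%N; case: (@word_span_closed z (letters_in 0)).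
  exists (maxn d1 d2).
  case: (@word_span_closed z (letters_in (maxn d1 d2))) => _; apply.
    by apply: word_span_sub h1; apply: mono; rewrite leq_maxl.
  by apply: word_span_sub h2; apply: mono; rewrite leq_maxr.
suff [n hn] : exists n, letters_in n s by exists n; apply: word_span_mem.
elim: s => [|i s [n hn]]; first by exists 0%N.
exists (n + absz i).+1; apply/andP; split; last by apply: mono hn; lia.
by case: i => i /=; rewrite ?NegzE; lia.
Qed.

(* A product of operators [K_i - v^e]; with all [e <> lam i] it separates the
   weight [lam] from finitely many others. *)
Definition wt_kill (l : seq (int * int)) (x : V) : V :=
  foldr (fun p y => K p.1 y - v ^ p.2 *: y) x l.

Fact wt_kill_linear l : linear (wt_kill l).
Proof.
move=> c x y; elim: l => //= p l ->.
rewrite linearP; lc_coefs k V; ring.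
Qed.
HB.instance Definition _ l :=
  GRing.isLinear.Build k V V _ (wt_kill l) (wt_kill_linear l).

Lemma wt_kill_cat l1 l2 x : wt_kill (l1 ++ l2) x = wt_kill l1 (wt_kill l2 x).
Proof. exact: foldr_cat. Qed.

Lemma wt_kill_K l i x : wt_kill l (K i x) = K i (wt_kill l x).
Proof.
elim: l => //= p l ->.
by rewrite rKK (linearB (K i)) (linearZ_LR (K i)).
Qed.

Lemma wt_kill_comm l1 l2 x : wt_kill l1 (wt_kill l2 x) = wt_kill l2 (wt_kill l1 x).
Proof.
elim: l1 => //= p l1 ->.
by rewrite -wt_kill_K (linearB (wt_kill l2)) (linearZ_LR (wt_kill l2)).
Qed.

Lemma wt_kill_wt l mu x : is_wt R mu x ->
  wt_kill l x = \prod_(p <- l) (v ^ mu p.1 - v ^ p.2) *: x.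
Proof.
move=> wx; elim: l => [|p l IH] /=; first by rewrite big_nil scale1r.
rewrite IH linearZ_LR wx big_cons; lc_coefs k V; ring.
Qed.

Definition separating (a : pred int) lam (l : seq (int * int)) :=
  all (fun p => a p.1 && (p.2 != lam p.1)) l.

Lemma separating_prod_neq0 a lam l : separating a lam l ->
  \prod_(p <- l) (v ^ lam p.1 - v ^ p.2) != 0.
Proof.
move=> h; rewrite prodf_seq_neq0; apply: sub_all h => p /andP[_ h] /=.
by rewrite subr_eq0; apply: contraNneq h => /vinj ->.
Qed.

(** Only the letter i - 1 can raise the weight at [i], and the least letter [i] itself lowers it. *)
Lemma word_wt_min lam s i : i \in s -> all (fun j => i <= j) s ->
  word_wt lam s i < lam i.
Proof.
move=> si hs; rewrite /word_wt -ltrBrDl subrr.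
have kle j : i <= j -> kwt i j <= 0.
  by rewrite /kwt /dlt; do 2!case: eqP => ?; lia.
elim: s si hs => //= j s IH; rewrite inE big_cons => /orP[/eqP<-|si] /andP[ij hs].
  have: \sum_(l <- s) kwt i l <= 0.
    elim: s hs {IH} => [|l s IH] /=; first by rewrite big_nil.
    move=> /andP[il /IH]; rewrite big_cons; have := kle _ il.
    by move: (kwt i l) (\sum_(_ <- s) _) => p q; lia.
  by rewrite kwt_same; move: (\sum_(_ <- s) _) => q; lia.
have := kle _ ij; have := IH si hs.
by move: (kwt i j) (\sum_(_ <- s) _) => p q; lia.
Qed.

Lemma word_min (s : seq int) : s != [::] ->
  exists2 i, i \in s & all (fun j => i <= j) s.
Proof.
elim: s => // i [|j s] IH _; first by exists i; rewrite ?inE //= lexx.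
have [l ls hl] := IH isT.
case: (leP l i) => il.
  by exists l; [rewrite inE ls orbT|apply/andP].
exists i; first by rewrite inE eqxx.
apply/andP; split=> //; apply: sub_all hl => m.
exact/le_trans/ltW.
Qed.

(** Each word is killed by one factor taken at its least letter; the factors commute, so lists are
    concatenated for sums. Using letters as indices keeps them inside [a], the range where two
    weights will be known to agree. *)
Lemma nonempty_span_killed (a : pred int) lam z x : is_wt R lam z ->
  word_span z (fun s => (s != [::]) && all a s) x ->
  exists2 l, separating a lam l & wt_kill l x = 0.
Proof.
move=> wz; move: x; apply: lspan_min => [|y [s /andP[s0 sa] ->]].
  split=> [|c x1 x2 [l1 h1 e1] [l2 h2 e2]]; first by exists [::].
  exists (l1 ++ l2); first by rewrite /separating all_cat; apply/andP.
  by rewrite linearP /= !wt_kill_cat (wt_kill_comm l1 l2 x1) e1 e2 !linear0 addr0.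
have [i si hi] := word_min s0.
exists [:: (i, word_wt lam s i)].
  rewrite /separating /= (allP sa) // andbT /=.
  by rewrite lt_eqF // word_wt_min.
by rewrite /= (wt_Fword s wz) subrr.
Qed.

Lemma word_span_split (a : pred int) z x : word_span z (all a) x ->
  exists c y, word_span z (fun s => (s != [::]) && all a s) y /\ x = c *: z + y.
Proof.
set B : pred (seq int) := fun s => (s != [::]) && all a s.
have cl := @word_span_closed z B.
move: x; apply: lspan_min => [|y [[_|i s hs] ->]].
- split=> [|c x1 x2 [c1 [y1 [h1 e1]]] [c2 [y2 [h2 e2]]]].
    by exists 0, 0; split; [case: cl|rewrite scale0r addr0].
  exists (c * c1 + c2), (c *: y1 + y2); split; first by case: cl => _; apply.
  by rewrite e1 e2; lc_coefs k V; ring.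
- by exists 1, 0; split; [case: cl|rewrite scale1r addr0].
- exists 0, (Fword z (i :: s)); split; last by rewrite scale0r add0r.
  exact: word_span_mem.
Qed.

(** Induction on the number of terms: two terms of equal weight are merged, and for different
    weights an operator [K i - c] deletes one of them without leaving [N]. *)
Lemma wt_vector_of_sum (N : V -> Prop) (t : seq ((int -> int) * V)) :
  lin_closed N -> (forall i x, N x -> N (K i x)) ->
  (forall i, (i < size t)%N ->
     is_wt R (nth (fun=> 0, 0) t i).1 (nth (fun=> 0, 0) t i).2) ->
  N (\sum_(p <- t) p.2) -> \sum_(p <- t) p.2 != 0 ->
  exists mu y, [/\ N y, y != 0 & is_wt R mu y].
Proof.
move=> Nl NK; have [r] := ubnP (size t); elim: r t => // r IH.
case=> [|[m1 y1] [|[m2 y2] t]] /= tr wt.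
- by rewrite big_nil eqxx.
- by rewrite big_seq1 => Ny y0; exists m1, y1; split=> //; apply: (wt 0%N).
rewrite !big_cons /=; set S := \sum_(_ <- _) _ => Nx x0.
have w1 : is_wt R m1 y1 by apply: (wt 0%N).
have w2 : is_wt R m2 y2 by apply: (wt 1%N).
have [eqm|/not_all_ex_not[i hi]] := classic (forall i, m1 i = m2 i).
  apply: (IH ((m1, y1 + y2) :: t)); rewrite ?big_cons -/S -?addrA //.
  case=> [_ i|i hi] /=; last exact: (wt i.+2).
  by rewrite linearD w1 w2 eqm scalerDr.
pose T (c : k) : seq ((int -> int) * V) :=
  [seq (p.1, (v ^ p.1 i - c) *: p.2) | p <- t].
have wT c j : (j < size (T c))%N -> is_wt R (nth (fun=> 0, 0) (T c) j).1
    (nth (fun=> 0, 0) (T c) j).2.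
  rewrite size_map => jt; rewrite (nth_map (fun=> 0, 0)) //= => l.
  by rewrite linearZ_LR (wt j.+2) // !scalerA mulrC.
have KS c : K i S - c *: S = \sum_(p <- T c) p.2.
  rewrite big_map /S raddf_sum scaler_sumr -sumrB !(big_nth (fun=> 0, 0)).
  rewrite !big_mkord; apply: eq_bigr => j _.
  by rewrite /= (wt j.+2) ?ltnS ?ltn_ord // scalerBl.
set x := _ + _ in Nx x0.
have Kx c : K i x - c *: x = (v ^ m1 i - c) *: y1 + (v ^ m2 i - c) *: y2
    + \sum_(p <- T c) p.2.
  rewrite -KS /x !(linearD (K i)) w1 w2; lc_coefs k V; ring.
have NKx c : N (K i x - c *: x).
  by apply: (lin_closedB Nl); [apply: NK|apply: (lin_closedZ _ Nl)].
have step c m y : is_wt R m y -> K i x - c *: x = y + \sum_(p <- T c) p.2 ->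
    K i x - c *: x != 0 -> exists mu z, [/\ N z, z != 0 & is_wt R mu z].
  move=> wy e; rewrite e => n0; apply: (IH ((m, y) :: T c)).
  - by rewrite /= size_map.
  - by case=> [|j] //=; apply: wT.
  - by rewrite big_cons -e; apply: NKx.
  - by rewrite big_cons.
have wtZ c m y : is_wt R m y -> is_wt R m (c *: y).
  by move=> h l; rewrite linearZ_LR h !scalerA mulrC.
have [e1|n1] := eqVneq (K i x - v ^ m1 i *: x) 0; last first.
  apply: (step _ m2 _ (wtZ (v ^ m2 i - v ^ m1 i) _ _ w2) _ n1).
  by rewrite Kx subrr scale0r add0r.
(* Deleting the first term gave zero, so [x] is an eigenvector of [K i] with value [v ^ m1 i].
   Deleting the second term instead multiplies [x] by a nonzero scalar. *)
apply: (step (v ^ m2 i) m1 _ (wtZ (v ^ m1 i - v ^ m2 i) _ _ w1)).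
  by rewrite Kx subrr scale0r addr0.
move/eqP: e1; rewrite subr_eq0 => /eqP->; rewrite -scalerBl scaler_eq0 negb_or x0.
by rewrite subr_eq0 andbT; apply/eqP => /vinj.
Qed.

Lemma word_span_wt_sum lam z A x : is_wt R lam z -> word_span z A x ->
  exists t : seq ((int -> int) * V),
   (forall i, (i < size t)%N ->
     is_wt R (nth (fun=> 0, 0) t i).1 (nth (fun=> 0, 0) t i).2) /\
   x = \sum_(p <- t) p.2.
Proof.
move=> wz; move: x; apply: lspan_min => [|y [s _ ->]]; last first.
  exists [:: (word_wt lam s, Fword z s)]; rewrite big_seq1; split=> //.
  by case=> //= _; apply: wt_Fword.
split=> [|c x1 x2 [t1 [h1 e1]] [t2 [h2 e2]]].
  by exists [::]; rewrite big_nil.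
exists ([seq (p.1, c *: p.2) | p <- t1] ++ t2); split; last first.
  by rewrite big_cat big_map /= e1 e2 scaler_sumr.
move=> i; rewrite size_cat size_map nth_cat size_map => hi.
case: ltnP => h; last by apply: h2; rewrite -(ltn_add2l (size t1)) subnKC.
rewrite (nth_map (fun=> 0, 0)) //= => l.
by rewrite linearZ_LR h1 // !scalerA mulrC.
Qed.

(** Every [E_i] lowers the bound on the length of the words spanning [y], and bound 0 leaves only
    the zero vector. *)
Lemma raise_to_singular lam one (N : V -> Prop) d mu y : is_hw lam one ->
  lin_closed N -> (forall i x, N x -> N (E i x)) ->
  N y -> y != 0 -> is_wt R mu y -> word_span one (shorter d) y ->
  exists nu z, [/\ N z, z != 0, is_hw nu z & word_span one predT z].
Proof.
move=> hone Nl NE; elim: d mu y => [|d IH] mu y Ny y0 wy yd.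
  case/eqP: y0; move: y yd {Ny wy}; apply: lspan_min => [|y [s]];
    last by rewrite /shorter ltn0.
  by split=> // c x1 x2 -> ->; rewrite scaler0 addr0.
have [Ey|/not_all_ex_not[i /eqP Ey]] := classic (forall i, E i y = 0).
  exists mu, y; split=> //.
  exact: (@word_span_sub _ (shorter d.+1) predT (fun _ _ => isT)).
apply: (IH _ (E i y)) => //; first exact: NE.
  exact: (wt_E v0 i wy).
exact: (hw_span_E i hone yd).
Qed.

(** The scalar is the product of q-integers [m+1] [t-m] with t = mu i - mu (i + 1), as in the
    representation theory of quantum sl2. *)
Lemma sl2_EF i mu y m : E i y = 0 -> is_wt R mu y ->
  E i (iter m.+1 (F i) y) =
  ((v ^ m.+1 - v ^ (- m.+1%:Z)) * (v ^ (mu i - mu (i + 1) - m%:Z)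
      - v ^ (m%:Z - (mu i - mu (i + 1)))) / (v - v^-1) ^+ 2)
   *: iter m (F i) y.
Proof.
move=> Ey wy.
have wF n : is_wt R (fun l => mu l + n%:Z * kwt l i) (iter n (F i) y).
  elim: n => [|n IHn] l; first by rewrite mul0r addr0 wy.
  rewrite iterS (wt_F v0 i IHn); congr (v ^ _ *: _).
  by rewrite intS mulrDl mul1r -addrA; congr (_ + _); apply: addrC.
set t := mu i - mu (i + 1).
have hF n : rKt R i (iter n (F i) y) - rKti R i (iter n (F i) y)
   = (v ^ (t - n%:Z - n%:Z) - v ^ (n%:Z + n%:Z - t)) *: iter n (F i) y.
  rewrite (wt_Kt v0 (wF n)) (wt_Kti v0 (wF n)) kwt_same kwt_next scalerBl.
  by congr (v ^ _ *: _ - v ^ _ *: _); rewrite /t; lia.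
clearbody t; have q0 := vBV_neq0 vinj.
have vv1 : v * v - 1 != 0.
  by apply: contra_neq q0 => h; apply: (mulfI v0); rewrite mulrBr mulfV ?h ?mulr0.
elim: m => [|m IH].
  rewrite /= rEF_same Ey linear0 add0r (hF 0%N) scalerA; congr (_ *: _).
  have -> : t - 0%:Z - 0%:Z = t by lia.
  have -> : 0%:Z + 0%:Z - t = - t by lia.
  have -> : t - 0%:Z = t by lia.
  rewrite -!invr_expz (_ : v ^ 1%:Z = v) //.
  by have := expfz_neq0 t v0; move: (v ^ t) => a a0; field; rewrite ?v0 ?vv1 ?a0.
rewrite iterS rEF_same IH hF linearZ_LR -iterS scalerA -scalerDl.
congr (_ *: _).
have -> : m.+2%:Z = m%:Z + 1 + 1 by lia.
have -> : m.+1%:Z = m%:Z + 1 by lia.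
rewrite !(opprD, opprB) !expfzDr // !expr1z !exprN1 -!invr_expz.
have := expfz_neq0 t v0; have := expfz_neq0 m%:Z v0.
move: (v ^ t) (v ^ m%:Z) => a b b0 a0.
by field; rewrite ?v0 ?vv1 ?b0 ?a0.
Qed.

(** At the first vanishing power [m.+1] the formula forces [m+1] [t-m] = 0, hence t = m >= 0. *)
Lemma sl2_dominant i mu y n : y != 0 -> E i y = 0 -> is_wt R mu y ->
  iter n (F i) y = 0 -> mu (i + 1) <= mu i.
Proof.
move=> y0 Ey wy Fy.
have exn : exists n, iter n (F i) y == 0 by exists n; rewrite Fy.
case: (ex_minnP exn) => -[|m] /eqP Fm min; first by case/eqP: y0.
have Fm0 : iter m (F i) y != 0.
  by apply/negP => /min; rewrite ltnn.
have /eqP := sl2_EF m Ey wy; rewrite Fm linear0 eq_sym scaler_eq0 (negbTE Fm0) orbF.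
rewrite mulf_eq0 mulf_eq0 invr_eq0 expf_eq0 /= (negbTE (vBV_neq0 vinj)) orbF.
by rewrite !subr_eq0 => /orP[] /eqP/vinj; lia.
Qed.

Lemma iter_F_far i j n x : 1 < `|i - j| ->
  iter n (F i) (F j x) = F j (iter n (F i) x).
Proof. by move=> ij; elim: n => //= n ->; rewrite rFF. Qed.

(** By the Serre relation at most one [F i] has to stay to the left of [F j]. Thus a new letter
    raises the nilpotency exponent by at most one. *)
Lemma iter_F_near i j n : `|i - j| = 1 -> exists a b : k, forall x,
  iter n.+1 (F i) (F j x) = a *: F i (F j (iter n (F i) x))
    + b *: F j (iter n.+1 (F i) x).
Proof.
move=> ij; elim: n => [|n [a [b IH]]].
  by exists 1, 0 => x; rewrite scale1r scale0r addr0.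
exists (a * (v + v^-1) + b), (- a) => x.
rewrite iterS IH linearD !(linearZ_LR (F i)).
have /eqP := rserreF R ij (iter n (F i) x).
rewrite addrAC subr_eq0 => /eqP h.
have -> : F i (F i (F j (iter n (F i) x))) = (v + v^-1) *:
    F i (F j (iter n.+1 (F i) x)) - F j (iter n.+2 (F i) x).
  by rewrite /= -h addrK.
lc_coefs k V; ring.
Qed.

Lemma F_locally_nilpotent one i n : iter n (F i) one = 0 ->
  forall x, word_span one predT x -> exists m, iter m (F i) x = 0.
Proof.
move=> F1.
have itlin m c x y : iter m (F i) (c *: x + y)
    = c *: iter m (F i) x + iter m (F i) y.
  by elim: m => //= m ->; rewrite linearP.
have it0 m : iter m (F i) 0 = 0 by elim: m => //= m ->; rewrite linear0.
have mono m1 m2 x : iter m1 (F i) x = 0 -> iter (m2 + m1) (F i) x = 0.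
  by move=> h; rewrite iterD h it0.
apply: lspan_min => [|x [s _ ->]].
  split=> [|c x y [m1 h1] [m2 h2]]; first by exists 0%N.
  exists (m1 + m2)%N; rewrite itlin (mono _ _ _ h2) addnC (mono _ _ _ h1).
  by rewrite scaler0 addr0.
elim: s => [|j s [m IH]]; first by exists n.
have [->|ji] := eqVneq j i; first by exists m; rewrite /= -iterSr iterS IH linear0.
case: (ltP 1 `|i - j|) => hij.
  by exists m; rewrite [Fword _ _]/= iter_F_far // IH linear0.
have [|a [b h]] := @iter_F_near i j m; first by lia.
by exists m.+1; rewrite [Fword _ _]/= h iterS IH !linear0 addr0.
Qed.

(** The form in which transcendence of [v] enters. *)
Hypothesis vindep : forall n (f g : nat -> int),
  (forall i j, (i < j)%N -> f i < f j) -> (forall i j, (i < j)%N -> g i < g j) ->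
  \sum_(i < n) v ^ f i = \sum_(i < n) v ^ g i -> forall i, (i < n)%N -> f i = g i.

(** With [b = n] and [n + n] steps the [cidx j] are exactly the letters -n, ..., n - 1, so the
    operator passes through the whole word down to [one]. *)
Lemma casimir_Fword lam one n s : is_hw lam one -> letters_in n s ->
  casimir R n%:Z (n + n) (Fword one s)
  = (\sum_(j < (n + n).+1) v ^ (2 * (lam (n%:Z - j%:Z) + j%:Z))) *: Fword one s.
Proof.
move=> [Eone wone]; elim: s => [_|i s IH /andP[hi /IH hs]] /=.
  exact: casimir_singular.
have [j jn ->] : exists2 j, (j < n + n)%N & i = cidx n%:Z j.
  exists (absz (n%:Z - 1 - i)%R); first by lia.
  by rewrite /cidx; lia.
by rewrite (casimir_F R vinj v0) // hs linearZ_LR.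
Qed.

Lemma casimir_span lam one n x : is_hw lam one ->
  word_span one (letters_in n) x ->
  casimir R n%:Z (n + n) x
  = (\sum_(j < (n + n).+1) v ^ (2 * (lam (n%:Z - j%:Z) + j%:Z))) *: x.
Proof.
move=> hone; move: x; apply: lspan_min => [|x [s hs ->]]; last exact: casimir_Fword.
have cl c x y : casimir R n%:Z (n + n) (c *: x + y)
    = c *: casimir R n%:Z (n + n) x + casimir R n%:Z (n + n) y.
  rewrite /casimir scaler_sumr -big_split; apply: eq_bigr => j _ /=.
  by rewrite linearP scalerDr !scalerA mulrC.
split=> [|c x y hx hy]; last by rewrite cl hx hy; lc_coefs k V; ring.
rewrite scaler0 /casimir big1 // => j _; by rewrite linear0 scaler0.
Qed.

(* A singular vector has dominant weight, and the Casimir eigenvalue separates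
   dominant weights. *)
Lemma singular_in_line lam one mu z : dominant lam -> is_hw lam one ->
  (forall i, exists n, iter n (F i) one = 0) ->
  word_span one predT z -> z != 0 -> is_hw mu z ->
  exists2 c, c != 0 & z = c *: one.
Proof.
move=> dlam hone nil zs z0 hz.
have dmu : dominant mu.
  move=> i; have [n Fn] := nil i; have [m Fm] := F_locally_nilpotent Fn zs.
  by case: hz => Ez wz; apply: (sl2_dominant z0 (Ez i) wz Fm).
have [n zn] := word_span_letters zs.
have incr nu : dominant nu -> forall i j, (i < j)%N ->
    2 * (nu (n%:Z - i%:Z) + i%:Z) < 2 * (nu (n%:Z - j%:Z) + j%:Z).
  move=> dnu i j ij; rewrite ltr_pM2l //.
  have : nu (n%:Z - i%:Z) <= nu (n%:Z - j%:Z); last by lia.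
  elim: j ij => // j IH; rewrite ltnS leq_eqVlt => /orP[/eqP->|/IH h].
    by have := dnu (n%:Z - j.+1%:Z); rewrite (_ : _ + 1 = n%:Z - j%:Z) //; lia.
  apply: (le_trans h).
  by have := dnu (n%:Z - j.+1%:Z); rewrite (_ : _ + 1 = n%:Z - j%:Z) //; lia.
(* The eigenvalue on [z] is computed twice: [z] is singular of weight [mu], and it is a combination
   of words applied to [one]. By [incr] both lists of exponents increase, so they agree entry by
   entry. *)
have eqlm i : (- n%:Z <= i) && (i <= n%:Z) -> lam i = mu i.
  move=> hi; have := casimir_span hone zn.
  rewrite (casimir_singular vinj v0 _ _ hz.2 hz.1) => /eqP.
  rewrite -subr_eq0 -scalerBl scaler_eq0 (negbTE z0) orbF subr_eq0 => /eqP h.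
  have /(_ (absz (n%:Z - i)%R)) := vindep (incr _ dmu) (incr _ dlam) h.
  rewrite (_ : n%:Z - (absz (n%:Z - i)%R)%:Z = i); last by lia.
  by move=> hh; have := hh ltac:(lia); lia.
have [c [y [ys zE]]] := word_span_split zn.
have [l lsep ly] := nonempty_span_killed hone.2 ys.
have p0 := separating_prod_neq0 lsep.
(* All indices in [l] lie where [mu] and [lam] agree, so [wt_kill l] multiplies [z] and [one] by the
   same nonzero scalar, and it kills [y]. *)
have zz : z = c *: one.
  apply: (scalerI p0); rewrite scalerA mulrC -scalerA -(wt_kill_wt l hone.2).
  transitivity (wt_kill l z); last by rewrite zE linearP /= ly addr0.
  rewrite (wt_kill_wt l hz.2); congr (_ *: _); apply: eq_big_seq => p pl.
  have /andP[hp _] := allP lsep p pl.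
  by rewrite eqlm //; move: hp => /= /andP[-> /ltW->].
exists c => //; apply: contraNneq z0 => c0.
by rewrite zz c0 scale0r.
Qed.

Lemma hw_submodule_top lam one (N : V -> Prop) x : dominant lam -> is_hw lam one ->
  (forall i, exists n, iter n (F i) one = 0) ->
  lin_closed N -> (forall i y, N y -> N (E i y)) -> (forall i y, N y -> N (K i y)) ->
  N x -> x != 0 -> word_span one predT x -> N one.
Proof.
move=> dlam hone nil Nl NE NK Nx x0 xs.
have [d xd] := word_span_shorter xs.
have [t [wt xE]] := word_span_wt_sum hone.2 xd.
(* The length bound is built into the subspace so that the weight vector extracted from it can still
   be raised; the K's preserve it, the words being weight vectors. *)
pose N' y := N y /\ word_span one (shorter d) y.
have cl := word_span_closed one (shorter d).
have N'l : lin_closed N'.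
  split=> [|c y1 y2 [h1 h2] [h3 h4]]; first by split; [case: Nl|case: cl].
  by split; [case: Nl => _; apply|case: cl => _; apply].
have N'K i y : N' y -> N' (K i y).
  by case=> h1 h2; split; [apply: NK|apply: word_span_K hone.2 h2].
have N'x : N' (\sum_(p <- t) p.2) by rewrite -xE; split.
have x0' : \sum_(p <- t) p.2 != 0 by rewrite -xE.
have [mu [y [[Ny yd] y0 wy]]] := wt_vector_of_sum N'l N'K wt N'x x0'.
have [nu [z [Nz z0 hz zs]]] := raise_to_singular hone Nl NE Ny y0 wy yd.
have [c c0 zE] := singular_in_line dlam hone nil zs z0 hz.
by rewrite -[one]scale1r -(mulVf c0) -scalerA -zE; apply: (lin_closedZ _ Nl).
Qed.

End HighestWeight.

(** * Powers of v *)

Lemma qv_neq0 : qv != 0.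
Proof. by rewrite /qv tofrac_eq0 polyX_eq0. Qed.

(** Two increasing enumerations of one finite set coincide: the value [f i] can only be met by [g]
    at an index at least [i], smaller ones being already matched, and conversely. *)
Lemma incr_same_image n (f g : nat -> int) :
  (forall i j, (i < j)%N -> f i < f j) -> (forall i j, (i < j)%N -> g i < g j) ->
  (forall i, (i < n)%N -> exists2 j, (j < n)%N & g j = f i) ->
  (forall i, (i < n)%N -> exists2 j, (j < n)%N & f j = g i) ->
  forall i, (i < n)%N -> f i = g i.
Proof.
move=> fi gi fg gf i; elim/ltn_ind: i => i IH ltin.
have [j jn gj] := fg _ ltin; have [l ln fl] := gf _ ltin.
have ij : (i <= j)%N.
  rewrite leqNgt; apply/negP => ji.
  by have := fi _ _ ji; rewrite (IH _ ji jn) gj ltxx.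
have il : (i <= l)%N.
  rewrite leqNgt; apply/negP => li.
  by have := gi _ _ li; rewrite -(IH _ li ln) fl ltxx.
have h1 : g i <= f i.
  by rewrite -gj; move: ij; rewrite leq_eqVlt => /orP[/eqP->//|/gi/ltW].
have h2 : f i <= g i.
  by rewrite -fl; move: il; rewrite leq_eqVlt => /orP[/eqP->//|/fi/ltW].
by apply/eqP; rewrite eq_le h2.
Qed.

Lemma qv_nat (m : nat) : qv ^ m%:Z = tofrac ('X^m : {poly rat}).
Proof. by rewrite -exprnP /qv -rmorphXn. Qed.

Lemma qv_sum_image n (f g : nat -> int) :
  \sum_(i < n) qv ^ f i = \sum_(i < n) qv ^ g i ->
  forall i, (i < n)%N -> exists2 j, (j < n)%N & g j = f i.
Proof.
move=> fg i ltin.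
(* [N] bounds all exponents in absolute value; multiplying by v^N gives an identity of
   polynomials. *)
pose N := (\sum_(j < n) (absz (f j) + absz (g j)))%N.
have hN j : (j < n)%N -> 0 <= f j + N%:Z /\ 0 <= g j + N%:Z.
  move=> jn; suff : (absz (f j) + absz (g j) <= N)%N by lia.
  by rewrite /N (bigD1 (Ordinal jn)) //= leq_addr.
pose f' j := absz (f j + N%:Z)%R; pose g' j := absz (g j + N%:Z)%R.
have eX : \sum_(j < n) 'X^(f' j) = \sum_(j < n) 'X^(g' j) :> {poly rat}.
  apply/eqP; rewrite -tofrac_eq !raddf_sum; apply/eqP.
  have E (h : nat -> int) (h' : nat -> nat) :
      (forall j, (j < n)%N -> (h' j)%:Z = h j + N%:Z) ->
      \sum_(j < n) tofrac ('X^(h' j) : {poly rat})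
      = qv ^ N%:Z * \sum_(j < n) qv ^ h j.
    move=> hh; rewrite mulr_sumr; apply: eq_bigr => j _.
    by rewrite -qv_nat hh // expfzDr ?qv_neq0 // mulrC.
  rewrite (E f) ?(E g) ?fg // => j jn; rewrite /g' /f' gez0_abs //; case: (hN j jn) => //.
have := congr1 (fun p : {poly rat} => p`_(f' i)) eX.
rewrite !coef_sum (bigD1 (Ordinal ltin)) //= coefXn eqxx => h.
have [j /eqP gj|none] := pickP (fun j : 'I_n => g' j == f' i).
  exists j => //; have [a1 a2] := hN j (ltn_ord j); have [b1 b2] := hN i ltin.
  by move: gj; rewrite /g' /f'; lia.
move: h; rewrite [RHS]big1 => [h|j _]; last by rewrite coefXn eq_sym none.
(* Coefficients count occurrences, so they are nonnegative rationals and cannot cancel. *)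
have : 0 < 1 + \sum_(j < n | j != Ordinal ltin) ('X^(f' j))`_(f' i) :> rat.
  by apply: ltr_wpDr => //; apply: sumr_ge0 => j _; rewrite coefXn ler0n.
by rewrite h ltxx.
Qed.

Lemma qv_indep n (f g : nat -> int) :
  (forall i j, (i < j)%N -> f i < f j) -> (forall i j, (i < j)%N -> g i < g j) ->
  \sum_(i < n) qv ^ f i = \sum_(i < n) qv ^ g i ->
  forall i, (i < n)%N -> f i = g i.
Proof.
move=> fi gi fg; apply: incr_same_image => //.
  exact: qv_sum_image.
by apply: qv_sum_image; rewrite fg.
Qed.

Lemma qv_inj (m n : int) : qv ^ m = qv ^ n -> m = n.
Proof.
move=> h; have := @qv_sum_image 1 (fun=> m) (fun=> n).
by rewrite !big_ord1 => /(_ h 0%N isT)[].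
Qed.

Lemma qint_neq0 (m : nat) : qint m.+1%:Z != 0.
Proof.
apply: mulf_neq0; last by rewrite invr_eq0 (vBV_neq0 qv_inj).
by rewrite subr_eq0; apply/negP => /eqP/qv_inj; lia.
Qed.

Lemma qfact_neq0 m : qfact m != 0.
Proof.
rewrite /qfact prodf_seq_neq0; apply/allP => -[|t]; rewrite mem_index_iota //= => _.
exact: qint_neq0.
Qed.

(** * Quotients by left ideals *)

Section LeftQuotient.
Variables (k : fieldType) (A : lalgType k).

Definition left_ideal (P : A -> Prop) :=
  lin_closed P /\ forall a b, P b -> P (a * b).

Definition lid P (hP : left_ideal P) : {pred A} :=
  fun x => if excluded_middle_informative (P x) then true else false.

Lemma lidP P (hP : left_ideal P) x : reflect (P x) (x \in lid hP).
Proof.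
by rewrite unfold_in /lid; case: excluded_middle_informative => h; constructor.
Qed.

Fact lid_zmod_closed P (hP : left_ideal P) : zmod_closed (lid hP).
Proof.
split=> [|x y /lidP Px /lidP Py]; apply/lidP; first by case: hP => -[].
exact: (lin_closedB hP.1).
Qed.
HB.instance Definition _ P (hP : left_ideal P) :=
  GRing.isZmodClosed.Build A (lid hP) (lid_zmod_closed hP).

Definition lquot P (hP : left_ideal P) := Quotient.quot (lid hP).
HB.instance Definition _ P (hP : left_ideal P) := GRing.Zmodule.on (lquot hP).

(** An [lalgType] only provides c (a b) = (c a) b; linearity of left multiplication needs this
    second law. *)
Hypothesis mulZ : forall c (a b : A), a * (c *: b) = c *: (a * b).
Variables (P : A -> Prop) (hP : left_ideal P).
Local Notation Q := (lquot hP).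

Definition lpi (a : A) : Q := (\pi_(Quotient.quot (lid hP)) a)%qT.

Lemma lpi_eq a b : lpi a = lpi b <-> P (a - b).
Proof.
split=> [/eqP|h]; last apply/eqP.
  by rewrite -Quotient.idealrBE => /lidP.
by rewrite -Quotient.idealrBE; apply/lidP.
Qed.

Lemma lpiD a b : lpi (a + b) = lpi a + lpi b.
Proof. exact: raddfD. Qed.

Definition lrepr (x : Q) : A := repr (x : Quotient.quot (lid hP)).
Lemma lreprK x : lpi (lrepr x) = x.
Proof. exact: reprK. Qed.

Lemma lpi_surj x : exists a, x = lpi a.
Proof. by exists (lrepr x); rewrite lreprK. Qed.

Definition lscale (c : k) (x : Q) : Q := lpi (c *: lrepr x).

Lemma lpiZ c a : lscale c (lpi a) = lpi (c *: a).
Proof.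
apply/lpi_eq; rewrite -scalerBr; apply: lin_closedZ; first by case: hP.
by apply/lpi_eq; rewrite lreprK.
Qed.

Fact lscaleA a b x : lscale a (lscale b x) = lscale (a * b) x.
Proof. by case: (lpi_surj x) => y ->; rewrite !lpiZ scalerA. Qed.
Fact lscale1 : left_id 1 lscale.
Proof. by move=> x; case: (lpi_surj x) => y ->; rewrite lpiZ scale1r. Qed.
Fact lscaleDr : right_distributive lscale +%R.
Proof.
move=> c x y; case: (lpi_surj x) => x' ->; case: (lpi_surj y) => y' ->.
by rewrite -lpiD !lpiZ scalerDr lpiD.
Qed.
Fact lscaleDl x : {morph lscale^~ x : a b / a + b}.
Proof. by move=> a b; case: (lpi_surj x) => y ->; rewrite !lpiZ scalerDl lpiD. Qed.
HB.instance Definition _ :=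
  GRing.Zmodule_isLmodule.Build k Q lscaleA lscale1 lscaleDr lscaleDl.

Fact lpi_linear : linear lpi.
Proof. by move=> c a b; rewrite lpiD -lpiZ. Qed.
HB.instance Definition _ := GRing.isLinear.Build k A Q _ lpi lpi_linear.

Lemma lpi_scale c a : c *: lpi a = lpi (c *: a).
Proof. exact: lpiZ. Qed.
Lemma lpi0 : lpi 0 = 0. Proof. exact: raddf0. Qed.
Lemma lpiN a : lpi (- a) = - lpi a. Proof. exact: raddfN. Qed.

Definition lact (a : A) (x : Q) : Q := lpi (a * lrepr x).

Lemma lactE a b : lact a (lpi b) = lpi (a * b).
Proof.
apply/lpi_eq; rewrite -mulrBr; apply: hP.2.
by apply/lpi_eq; rewrite lreprK.
Qed.

Fact lact_linear a : linear (lact a).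
Proof.
move=> c x y; case: (lpi_surj x) => x' ->; case: (lpi_surj y) => y' ->.
by rewrite lpi_scale -lpiD !lactE lpi_scale -lpiD mulrDr mulZ.
Qed.
HB.instance Definition _ a :=
  GRing.isLinear.Build k Q Q _ (lact a) (lact_linear a).
Definition lmap a : {linear Q -> Q} := lact a.

Lemma lactM a b x : lact a (lact b x) = lact (a * b) x.
Proof. by case: (lpi_surj x) => y ->; rewrite !lactE mulrA. Qed.
Lemma lactD a b x : lact (a + b) x = lact a x + lact b x.
Proof. by case: (lpi_surj x) => y ->; rewrite !lactE mulrDl lpiD. Qed.
Lemma lactN a x : lact (- a) x = - lact a x.
Proof. by case: (lpi_surj x) => y ->; rewrite !lactE mulNr lpiN. Qed.
Lemma lactZ c a x : lact (c *: a) x = c *: lact a x.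
Proof. by case: (lpi_surj x) => y ->; rewrite !lactE -scalerAl lpi_scale. Qed.
Lemma lact1 x : lact 1 x = x.
Proof. by case: (lpi_surj x) => y ->; rewrite !lactE mul1r. Qed.

End LeftQuotient.

(** * Quotients of an algebra with the generators of U(infinity) by left ideals containing the
    relations *)

Section GeneratedAlgebra.
Variables (k : fieldType) (v : k) (A : lalgType k).

(** [A] stands for the free algebra. Elements satisfying [arel] need not vanish in [A]; they vanish
    on [A / P] once the left ideal [P] contains all their right multiples. *)
Record uinf_alg := UinfAlg {
  aE : int -> A;
  aF : int -> A;
  aK : int -> A;
  aKi : int -> A;
  arel : A -> Prop;
  amulZ : forall c (a b : A), a * (c *: b) = c *: (a * b);
  aKK : forall i j, arel (aK i * aK j - aK j * aK i);
  aKKi : forall i, arel (aK i * aKi i - 1);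
  aKiK : forall i, arel (aKi i * aK i - 1);
  aKE : forall i j, arel (aK i * aE j - v ^ (- kwt i j) *: (aE j * aK i));
  aKF : forall i j, arel (aK i * aF j - v ^ kwt i j *: (aF j * aK i));
  aFF : forall i j, 1 < `|i - j| -> arel (aF i * aF j - aF j * aF i);
  aEE : forall i j, 1 < `|i - j| -> arel (aE i * aE j - aE j * aE i);
  aEF : forall i j, arel (aE i * aF j - aF j * aE i - (dlt i j)%:~R *:
    ((v - v^-1)^-1 *: (aK i * aKi (i + 1) - aKi i * aK (i + 1))));
  aserre : forall i j, `|i - j| = 1 ->
    arel (aF i ^+ 2 * aF j - (v + v^-1) *: (aF i * aF j * aF i)
          + aF j * aF i ^+ 2);
  agen : forall S : A -> Prop, lin_closed S -> S 1 ->
    (forall i a, S a -> S (aE i * a)) -> (forall i a, S a -> S (aF i * a)) ->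
    (forall i a, S a -> S (aK i * a)) -> (forall i a, S a -> S (aKi i * a)) ->
    forall a, S a }.

Variable U : uinf_alg.
Local Notation mulZ := (amulZ U).

Section Quotient.
Variables (P : A -> Prop) (hP : left_ideal P).
Hypothesis relP : forall r b, arel U r -> P (r * b).

Lemma lact_rel r (x : lquot hP) : arel U r -> lact r x = 0.
Proof.
move=> hr; case: (lpi_surj x) => y ->; rewrite lactE -lpi0.
by apply/lpi_eq; rewrite subr0; apply: relP.
Qed.

Lemma lact_rel_eq a b (x : lquot hP) : arel U (a - b) -> lact a x = lact b x.
Proof.
by move=> h; apply/eqP; rewrite -subr_eq0 -lactN -lactD lact_rel.
Qed.

Definition lrep : uinf_rep v (lquot hP).
Proof.
refine (@UinfRep _ _ _ (fun i => lmap mulZ hP (aE U i))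
  (fun i => lmap mulZ hP (aF U i)) (fun i => lmap mulZ hP (aK U i))
  (fun i => lmap mulZ hP (aKi U i)) _ _ _ _ _ _ _ _ _); rewrite /lmap /=.
- by move=> i j x; rewrite !lactM; apply/lact_rel_eq/aKK.
- by move=> i x; rewrite lactM -[RHS]lact1; apply/lact_rel_eq/aKKi.
- by move=> i x; rewrite lactM -[RHS]lact1; apply/lact_rel_eq/aKiK.
- by move=> i j x; rewrite !lactM -lactZ; apply/lact_rel_eq/aKE.
- by move=> i j x; rewrite !lactM -lactZ; apply/lact_rel_eq/aKF.
- by move=> i j x ij; rewrite !lactM; apply/lact_rel_eq/aFF.
- by move=> i j x ij; rewrite !lactM; apply/lact_rel_eq/aEE.
- move=> i j x; rewrite !lactM -lactN -lactD -!lactZ -lactD.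
  by apply: lact_rel_eq; rewrite opprD addrA; apply: aEF.
- move=> i j ij x /=; rewrite !lactM -lactZ -lactN -!lactD.
  by rewrite -(lact_rel x (aserre U ij)) !expr2 !mulrA.
Defined.

Lemma lrep_hw lam : (forall i, P (aE U i)) ->
  (forall i, P (aK U i - (v ^ lam i)%:A)) -> is_hw lrep lam (lpi hP 1).
Proof.
move=> PE PK; split=> i /=; rewrite /lmap lactE mulr1.
  by rewrite -lpi0; apply/lpi_eq; rewrite subr0.
by rewrite lpi_scale; apply/lpi_eq.
Qed.

Hypothesis v0 : v != 0.

(** The span of F-words on a highest weight vector is stable under all four kinds of generators. *)
Lemma lrep_words lam (x : lquot hP) : is_hw lrep lam (lpi hP 1) ->
  word_span lrep (lpi hP 1) predT x.
Proof.
move=> hw; case: (lpi_surj x) => a ->; move: a.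
have cl := word_span_closed lrep (lpi hP 1) predT.
apply: (@agen U (fun a => word_span lrep (lpi hP 1) predT (lpi hP a))).
- split=> [|c a b ha hb]; first by rewrite lpi0; case: cl.
  by rewrite lpiD -lpi_scale; case: cl => _; apply.
- exact: (@word_span_mem _ _ _ lrep _ predT [::]).
- by move=> i a ha; rewrite -lactE; apply: (hw_spanT_E v0 i hw ha).
- move=> i a ha; rewrite -lactE.
  exact: (@word_span_F _ _ _ lrep _ predT predT i (fun _ _ => isT) _ ha).
- by move=> i a ha; rewrite -lactE; apply: (word_span_K v0 i hw.2 ha).
- by move=> i a ha; rewrite -lactE; apply: (word_span_Ki v0 i hw.2 ha).
Qed.

Lemma lpi_aF_exp i m : lpi hP (aF U i ^+ m) = iter m (rF lrep i) (lpi hP 1).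
Proof.
elim: m => [|m IH]; first by rewrite expr0.
by rewrite iterS -IH /= /lmap lactE exprS.
Qed.

End Quotient.

(** * The left ideal of M(lam)/I(lam) and its maximality *)

Section MaximalIdeal.
Hypothesis vinj : forall m n : int, v ^ m = v ^ n -> m = n.
Hypothesis v0 : v != 0.
Hypothesis vindep : forall n (f g : nat -> int),
  (forall i j, (i < j)%N -> f i < f j) -> (forall i j, (i < j)%N -> g i < g j) ->
  \sum_(i < n) v ^ f i = \sum_(i < n) v ^ g i -> forall i, (i < n)%N -> f i = g i.

Variables (lam : int -> int) (dlam : dominant lam).
Variables (J : A -> Prop) (hJ : left_ideal J).
Hypothesis relJ : forall r b, arel U r -> J (r * b).
Hypothesis EJ : forall i, J (aE U i).
Hypothesis KJ : forall i, J (aK U i - (v ^ lam i)%:A).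

Local Notation RM := (lrep hJ relJ).
Local Notation one := (lpi hJ 1).

Let one_hw : is_hw RM lam one := lrep_hw hJ relJ EJ KJ.

Definition int_vec i : lquot hJ := lpi hJ (aF U i ^+ mexp lam i).

Lemma int_vec_hw i : exists mu, is_hw RM mu (int_vec i).
Proof.
have [E1 w1] := one_hw; rewrite /int_vec (lpi_aF_exp hJ relJ).
have [mu wmu] : exists mu, is_wt RM mu (iter (mexp lam i) (rF RM i) one).
  elim: (mexp lam i) => [|m [mu IH]]; first by exists lam.
  by exists (fun l => mu l + kwt l i); apply: (wt_F v0 i IH).
exists mu; split=> // j; have [<-|ji] := eqVneq i j; last first.
  rewrite eq_sym in ji; elim: (mexp lam i) => [|m IH]; first exact: E1.
  by rewrite iterS rEF_diff // IH linear0.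
rewrite /mexp (sl2_EF vinj v0 _ (E1 i) w1).
rewrite gez0_abs ?subr_ge0 ?dlam // !subrr.
by rewrite mulr0 mul0r scale0r.
Qed.

Definition int_span := lspan (fun y => exists i s, y = Fword RM (int_vec i) s).

Lemma word_span_int i x : word_span RM (int_vec i) predT x -> int_span x.
Proof.
by apply: lspan_sub => y [s _ ->]; apply: lspan_mem; exists i, s.
Qed.

Definition int_ideal b := int_span (lpi hJ b).

Lemma int_ideal_closed : lin_closed int_ideal.
Proof.
have cl : lin_closed int_span by apply: lin_closed_span.
split=> [|c a b ha hb]; first by rewrite /int_ideal lpi0; case: cl.
by rewrite /int_ideal lpiD -lpi_scale; case: cl => _; apply.
Qed.

(** Each [int_vec i] is a highest weight vector, so the F-words on it already span a subspace stable
    under the [E]'s and [K]'s. *)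
Lemma int_ideal_left : left_ideal int_ideal.
Proof.
split=> [|a]; first exact: int_ideal_closed.
have cl := int_ideal_closed.
have stable (f : {linear lquot hJ -> lquot hJ}) :
    (forall i x, word_span RM (int_vec i) predT x ->
       word_span RM (int_vec i) predT (f x)) ->
    forall x, int_span x -> int_span (f x).
  move=> hf; apply: lspan_image => x [i [s ->]].
  by apply: (@word_span_int i); apply: hf; apply: word_span_mem.
move: a; apply: (@agen U (fun a => forall b, int_ideal b -> int_ideal (a * b))).
- split=> [b _|c a1 a2 h1 h2 b hb]; first by rewrite mul0r; case: cl.
  by rewrite mulrDl -scalerAl; case: cl => _; apply; [apply: h1|apply: h2].
- by move=> b; rewrite mul1r.
- move=> i a h b /h hb; rewrite -mulrA /int_ideal -lactE.
  apply: (stable (rE RM i)) hb => j x; have [mu hmu] := int_vec_hw j.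
  exact: (hw_spanT_E v0 i hmu).
- move=> i a h b /h hb; rewrite -mulrA /int_ideal -lactE.
  apply: (stable (rF RM i)) hb => j x; apply: word_span_F => //.
- move=> i a h b /h hb; rewrite -mulrA /int_ideal -lactE.
  apply: (stable (rK RM i)) hb => j x; have [mu hmu] := int_vec_hw j.
  exact: (word_span_K v0 i hmu.2).
- move=> i a h b /h hb; rewrite -mulrA /int_ideal -lactE.
  apply: (stable (rKi RM i)) hb => j x; have [mu hmu] := int_vec_hw j.
  exact: (word_span_Ki v0 i hmu.2).
Qed.

Lemma int_ideal_sub a : J a -> int_ideal a.
Proof.
move=> Ja; rewrite /int_ideal (_ : lpi hJ a = 0).
  by case: (lin_closed_span (fun y => exists i s, y = Fword RM (int_vec i) s)).
by rewrite -lpi0; apply/lpi_eq; rewrite subr0.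
Qed.

Lemma int_ideal_gen i : int_ideal (aF U i ^+ mexp lam i).
Proof. by apply: lspan_mem; exists i, [::]. Qed.

Lemma Fword_int_vec i s : Fword RM (int_vec i) s
  = lpi hJ (foldr (fun j a => aF U j * a) 1 s * aF U i ^+ mexp lam i).
Proof.
elim: s => [|j s IH] /=; first by rewrite mul1r.
by rewrite IH /lmap lactE mulrA.
Qed.

Lemma int_ideal_ind (S : A -> Prop) : lin_closed S -> (forall a, J a -> S a) ->
  (forall i s, S (foldr (fun j a => aF U j * a) 1 s * aF U i ^+ mexp lam i)) ->
  forall a, int_ideal a -> S a.
Proof.
move=> Sl JS FS a ha.
have [b bE Sb] : exists2 b, lpi hJ a = lpi hJ b & S b.
  apply: (@lspan_min _ _ _ (fun y => exists2 b, y = lpi hJ b & S b)) ha.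
    split=> [|c x y [b -> hb] [d -> hd]].
      by exists 0; [rewrite lpi0|case: Sl].
    exists (c *: b + d); first by rewrite lpiD lpi_scale.
    by case: Sl => _; apply.
  move=> y [i [s ->]]; rewrite Fword_int_vec.
  by exists (foldr (fun j a => aF U j * a) 1 s * aF U i ^+ mexp lam i).
rewrite -[a](subrK b); apply: (lin_closedD Sl) => //.
exact/JS/lpi_eq.
Qed.

(** Since [mexp] is at least 1, every spanning vector is a non-empty word applied to the top
    vector. *)
Lemma int_ideal_killed a : int_ideal a ->
  exists2 l, separating predT lam l & wt_kill RM l (lpi hJ a) = 0.
Proof.
move=> ha; apply: (nonempty_span_killed v0 one_hw.2).
apply: lspan_sub ha => y [i [s ->]].
have -> : Fword RM (int_vec i) s = Fword RM one (s ++ nseq (mexp lam i) i).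
  rewrite /Fword foldr_cat; congr foldr; rewrite /int_vec (lpi_aF_exp hJ relJ).
  by elim: (mexp lam i) => //= m ->.
by apply: word_span_mem; rewrite all_predT andbT -size_eq0 size_cat size_nseq addnS.
Qed.

(** [wt_kill] would annihilate the class of 1 and also multiply it by a nonzero scalar. The outcome
    is [J 1] and not a contradiction, since [A / J] could be zero here. *)
Lemma int_ideal_proper : int_ideal 1 -> J 1.
Proof.
move=> /int_ideal_killed[l lsep].
rewrite (wt_kill_wt l one_hw.2) => /eqP.
rewrite scaler_eq0 (negbTE (separating_prod_neq0 vinj lsep)) /= => /eqP h.
by rewrite -[1]subr0; apply/lpi_eq; rewrite h lpi0.
Qed.

(** If [a] were outside [int_ideal], the image of [P] in the quotient by [int_ideal] would be a
    nonzero submodule, hence would contain the top vector by [hw_submodule_top]. *)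
Lemma int_ideal_max (P : A -> Prop) a : left_ideal P ->
  (forall b, J b -> P b) -> ~ P 1 -> P a -> int_ideal a.
Proof.
move=> [Pl Pm] JP nP1 Pa; apply: NNPP => nIa; apply: nP1.
have relI r b : arel U r -> int_ideal (r * b).
  by move=> hr; apply: int_ideal_sub; apply: relJ.
pose hI := int_ideal_left; pose RI := lrep hI relI.
have hwI : is_hw RI lam (lpi hI 1).
  by apply: lrep_hw => i; apply: int_ideal_sub; [apply: EJ|apply: KJ].
have image_closed (B : A -> Prop) (hB : left_ideal B) :
    lin_closed (fun y : lquot hB => exists2 c, y = lpi hB c & P c).
  split=> [|c y1 y2 [c1 -> h1] [c2 -> h2]].
    by exists 0; [rewrite lpi0|case: Pl].
  by exists (c *: c1 + c2); [rewrite lpiD lpi_scale|case: Pl => _; apply].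
have [c c1 Pc] : exists2 c, lpi hI 1 = lpi hI c & P c.
  apply: (@hw_submodule_top _ _ _ RI vinj v0 vindep lam (lpi hI 1)
    (fun y => exists2 c, y = lpi hI c & P c) (lpi hI a)) => //.
  - move=> i; exists (mexp lam i); rewrite -(lpi_aF_exp hI relI) -lpi0.
    by apply/lpi_eq; rewrite subr0; apply: int_ideal_gen.
  - exact: image_closed.
  - by move=> i y [c -> Pc]; exists (aE U i * c); [rewrite -lactE|apply: Pm].
  - by move=> i y [c -> Pc]; exists (aK U i * c); [rewrite -lactE|apply: Pm].
  - by exists a.
  - by rewrite -lpi0; apply/eqP => /lpi_eq; rewrite subr0.
  - exact: (lrep_words v0 _ hwI).
(* So far 1 - c lies in [int_ideal], but [P] contains only [J] for certain. Applying [wt_kill l],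
   which kills 1 - c modulo [J] and keeps [c] in [P], puts a nonzero multiple of 1 into [P]. *)
have /lpi_eq/int_ideal_killed[l lsep] := c1.
rewrite lpiD lpiN linearB /= (wt_kill_wt l one_hw.2) => /eqP.
rewrite subr_eq0 => /eqP kE.
have [d dE Pd] : exists2 d, wt_kill RM l (lpi hJ c) = lpi hJ d & P d.
  elim: l {lsep kE} => [|p l [d dE Pd]] /=; first by exists c.
  rewrite dE /lmap lactE lpi_scale -lpiN -lpiD.
  exists (aK U p.1 * d - v ^ p.2 *: d) => //.
  by apply: (lin_closedB Pl); [apply: Pm|apply: (lin_closedZ _ Pl)].
have p0 := separating_prod_neq0 vinj lsep.
move: kE; rewrite dE lpi_scale => /lpi_eq/JP Pdiff.
rewrite -[1]scale1r -(mulVf p0) -scalerA; apply: (lin_closedZ _ Pl).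
by rewrite -[X in P X](subrK d); apply: (lin_closedD Pl).
Qed.

End MaximalIdeal.
End GeneratedAlgebra.

(** * Presentations of modules over the free algebra *)

Lemma malgU_scale c (m : fmonom gen) : << c *g m >> = c *: << m >> :> FA.
Proof. by apply/malgP => l; rewrite mcoeffZ !mcoeffU mulrnAr mulr1. Qed.

Lemma FA_mul_scale c (a b : FA) : a * (c *: b) = c *: (a * b).
Proof.
rewrite (malgMEw (fsubset_refl _) (msuppZ_le c b)) malgME scaler_sumr.
apply: eq_bigr => l _; rewrite scaler_sumr; apply: eq_bigr => m _.
by rewrite mcoeffZ mulrCA malgU_scale -scalerA -malgU_scale.
Qed.

Lemma fmonom_cons (g : gen) s :
  << FMonom (g :: s) >> = fgen g * << FMonom s >> :> FA.
Proof.
rewrite /fgen malgM_def fgmulUU mulr1; congr << _ >>.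
by apply/eqP; rewrite fmP fmM fmU.
Qed.

Lemma fmonom_cat (w1 w2 : fmonom gen) :
  << w1 >> * << w2 >> = << FMonom (w1 ++ w2) >> :> FA.
Proof.
rewrite malgM_def fgmulUU mulr1; congr << _ >>.
by apply/eqP; rewrite fmP fmM.
Qed.

Lemma fmonom_nil : << FMonom [::] >> = 1 :> FA.
Proof. by rewrite -fmoneE. Qed.

Lemma FA_ind (S : FA -> Prop) : lin_closed S -> S 1 ->
  (forall g a, S a -> S (fgen g * a)) -> forall a, S a.
Proof.
move=> Sl S1 Sg a; rewrite [a]monalgE; apply: lin_closed_sum => // m.
rewrite malgU_scale; apply: lin_closedZ => //; rewrite -[m]fmK.
elim: (m : seq gen) => [|g s IH]; first by rewrite fmonom_nil.
by rewrite fmonom_cons; apply: Sg.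
Qed.

Lemma gen_cases (S : gen -> Prop) : (forall i, S (tE, i)) -> (forall i, S (tF, i)) ->
  (forall i, S (tK, i)) -> (forall i, S (tKi, i)) -> forall g, S g.
Proof.
move=> hE hF hK hKi [[m hm] i].
case: m hm => [|[|[|[|//]]]] hm.
- by rewrite (_ : Ordinal hm = tE) //; apply: val_inj.
- by rewrite (_ : Ordinal hm = tF) //; apply: val_inj.
- by rewrite (_ : Ordinal hm = tK) //; apply: val_inj.
- by rewrite (_ : Ordinal hm = tKi) //; apply: val_inj.
Qed.

Definition FA_alg : uinf_alg qv FA.
Proof.
refine (@UinfAlg _ qv FA fE fF fK fKi Urel FA_mul_scale
  _ _ _ _ _ _ _ _ _ _).
- by move=> i j; left; exists i, j.
- by move=> i; right; left; exists i.
- by move=> i; right; right; left; exists i.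
- by move=> i j; do 3 right; left; exists i, j; rewrite /kwt opprB.
- by move=> i j; do 4 right; left; exists i, j.
- by move=> i j ij; do 6 right; left; exists i, j.
- by move=> i j ij; do 5 right; left; exists i, j.
- by move=> i j; do 7 right; left; exists i, j.
- by move=> i j ij; do 9 right; exists i, j.
- move=> S Sl S1 hE hF hK hKi; apply: FA_ind => // g.
  exact: (@gen_cases (fun g => forall a, S a -> S (fgen g * a)) hE hF hK hKi g).
Defined.

Definition span_closed (V : space) (S : V -> Prop) :=
  [/\ S (szero V), (forall y z, S y -> S z -> S (sadd y z)),
    (forall y, S y -> S (sopp y)) & (forall c y, S y -> S (sscale c y))].

Lemma span_min (V : space) (Q S : V -> Prop) : span_closed S ->
  (forall y, Q y -> S y) -> forall x, span Q x -> S x.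
Proof. by move=> [S0 SD SN SZ] QS x; apply. Qed.

Lemma span_mem (V : space) (Q : V -> Prop) x : Q x -> span Q x.
Proof. by move=> Qx S _ _ _ _; apply. Qed.

Definition subalg (D : FA -> Prop) :=
  lin_closed D /\ forall a b, D a -> D b -> D (a * b).

(* [N] is the quotient of the subalgebra [D] by the left ideal [P]. *)
Record pres (D : FA -> Prop) (N : umod) (f : FA -> N) (P : FA -> Prop) : Prop := Pres {
  pres_surj : forall x, exists2 a, D a & x = f a;
  pres0 : f 0 = szero N;
  presD : forall a b, D a -> D b -> f (a + b) = sadd (f a) (f b);
  presN : forall a, D a -> f (- a) = sopp (f a);
  presZ : forall c a, D a -> f (c *: a) = sscale c (f a);
  presM : forall a b, D a -> D b -> f (a * b) = uact a (f b);
  pres_eq : forall a b, D a -> D b -> f a = f b <-> P (a - b) }.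

Definition allA (a : FA) := True.

Lemma subalg_allA : subalg allA.
Proof. by []. Qed.

Lemma pres_ker0 D N f P a : subalg D -> @pres D N f P -> D a ->
  f a = szero N <-> P a.
Proof.
move=> [[D0 _] _] h Da; rewrite -(pres0 h).
by rewrite -[X in _ <-> P X]subr0; apply: (pres_eq h).
Qed.

Lemma pres_iso N f P N' f' P' : @pres allA N f P -> @pres allA N' f' P' ->
  (forall a, P a <-> P' a) -> umod_iso N N'.
Proof.
move=> h h' PP'.
have sur x : exists a, x = f a by have [a] := pres_surj h x; exists a.
have sur' x : exists a, x = f' a by have [a] := pres_surj h' x; exists a.
pose g x := proj1_sig (constructive_indefinite_description _ (sur x)).
pose g' x := proj1_sig (constructive_indefinite_description _ (sur' x)).
have gK x : f (g x) = x by rewrite /g; case: constructive_indefinite_description.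
have gK' x : f' (g' x) = x by rewrite /g'; case: constructive_indefinite_description.
have ff' a b : f a = f b <-> f' a = f' b.
  by rewrite (pres_eq h) // (pres_eq h') //; apply: PP'.
have fg a : f' (g (f a)) = f' a by apply/ff'; rewrite gK.
exists (fun x => f' (g x)); split.
  exists (fun x => f (g' x)) => x; last by rewrite fg gK'.
  by rewrite -[RHS]gK; apply/ff'; rewrite gK'.
split=> [x y|].
  by rewrite -[x]gK -[y]gK -(presD h) // !fg (presD h').
split=> [c x|a x].
  by rewrite -[x]gK -(presZ h) // !fg (presZ h').
by rewrite -[x]gK -(presM h) // !fg (presM h').
Qed.

Section QuotientPresentation.
Variables (D : FA -> Prop) (hD : subalg D) (N : umod) (f : FA -> N) (P : FA -> Prop).
Hypothesis h : pres D f P.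
Variable Q : N -> Prop.

Let D0 : D 0. Proof. by case: hD => -[]. Qed.
Let DD a b : D a -> D b -> D (a + b). Proof. exact: (lin_closedD hD.1). Qed.
Let DB a b : D a -> D b -> D (a - b). Proof. exact: (lin_closedB hD.1). Qed.
Let DN a : D a -> D (- a). Proof. by rewrite -sub0r; apply: DB. Qed.
Let DZ c a : D a -> D (c *: a). Proof. exact: (lin_closedZ _ hD.1). Qed.
Let DM a b : D a -> D b -> D (a * b). Proof. exact: hD.2. Qed.

Definition qker a := span Q (f a).

Lemma presB a b : D a -> D b -> f (a - b) = sadd (f a) (sopp (f b)).
Proof. by move=> Da Db; rewrite (presD h) ?(presN h) //; apply: DN. Qed.

Lemma qkerD a b : D a -> D b -> qker a -> qker b -> qker (a + b).
Proof. by move=> Da Db ha hb; rewrite /qker (presD h) //; apply: spanD. Qed.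
Lemma qkerN a : D a -> qker a -> qker (- a).
Proof. by move=> Da ha; rewrite /qker (presN h) //; apply: spanN. Qed.
Lemma qkerZ c a : D a -> qker a -> qker (c *: a).
Proof. by move=> Da ha; rewrite /qker (presZ h) //; apply: spanZ. Qed.
Lemma qkerB a b : D a -> D b -> qker a -> qker b -> qker (a - b).
Proof. by move=> Da Db ha hb; apply: qkerD => //; [apply: DN|apply: qkerN]. Qed.

Lemma qker_sub a : D a -> P a -> qker a.
Proof.
by move=> Da /(pres_ker0 hD h Da) Pa; rewrite /qker Pa; apply: span0.
Qed.

Lemma qmk_eq a b : D a -> D b -> qmk Q (f a) = qmk Q (f b) <-> qker (a - b).
Proof.
move=> Da Db; split=> [[] /(congr1 (fun X => X (f a)))|hab].
  rewrite /qcls -!presB // => e; rewrite /qker -e subrr.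
  by rewrite (pres0 h); apply: span0.
have e : qcls Q (f a) = qcls Q (f b).
  apply: functional_extensionality => x; apply: propositional_extensionality.
  have [c Dc ->] := pres_surj h x; rewrite /qcls -!presB //.
  split=> hc.
    have -> : c - b = (c - a) + (a - b) by rewrite addrA subrK.
    exact: (qkerD (DB Dc Da) (DB Da Db) hc hab).
  have -> : c - a = (c - b) - (a - b) by rewrite opprB addrA subrK.
  exact: (qkerB (DB Dc Db) (DB Da Db) hc hab).
rewrite /qmk; move: (ex_intro _ _ _) (ex_intro _ _ _); rewrite e => p q.
by congr exist; apply: proof_irrelevance.
Qed.

Lemma qmk_rep X : qmk Q (qrep X) = X.
Proof.
rewrite /qmk /qrep; case: constructive_indefinite_description => x /= e.
case: X e => Y p /= e; move: (ex_intro _ _ _); rewrite -e => q.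
by congr exist; apply: proof_irrelevance.
Qed.

Lemma qrep_pres X : exists2 a, D a & qrep X = f a /\ X = qmk Q (f a).
Proof.
have [a Da e] := pres_surj h (qrep X); exists a => //; split=> //.
by rewrite -e qmk_rep.
Qed.

(** The record [N] has no module axioms; additivity of the action is obtained by lifting vectors to
    [D] and multiplying there. *)
Lemma span_stable :
  (forall a x, D a -> Q x -> span Q (uact a x)) ->
  forall a x, D a -> span Q x -> span Q (uact a x).
Proof.
move=> Qs a x Da; move: x.
apply: (@span_min N Q (fun x => span Q (uact a x))) => [|x Qx]; last exact: Qs.
split=> [|x y|x|c x].
- rewrite -(pres0 h) -(presM h Da D0) mulr0 (pres0 h); exact: span0.
- have [b Db ->] := pres_surj h x; have [c Dc ->] := pres_surj h y.
  rewrite -(presD h Db Dc) -(presM h Da Db) -(presM h Da Dc).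
  rewrite -(presM h Da (DD Db Dc)) mulrDr (presD h (DM Da Db) (DM Da Dc)).
  exact: spanD.
- have [b Db ->] := pres_surj h x.
  rewrite -(presN h Db) -(presM h Da Db) -(presM h Da (DN Db)) mulrN.
  rewrite (presN h (DM Da Db)); exact: spanN.
- have [b Db ->] := pres_surj h x.
  rewrite -(presZ h c Db) -(presM h Da Db) -(presM h Da (DZ c Db)) FA_mul_scale.
  rewrite (presZ h c (DM Da Db)); exact: spanZ.
Qed.

Hypothesis stable : forall a x, D a -> span Q x -> span Q (uact a x).

Lemma qkerM a b : D a -> D b -> qker b -> qker (a * b).
Proof. by move=> Da Db hb; rewrite /qker (presM h) //; apply: stable. Qed.

(** Quotient operations use a chosen representative, which may differ from [f a]. The difference
    lies in [qker], a left ideal relative to [D] by [stable]. *)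
Lemma pres_quot : pres D (fun a => qmk Q (f a) : qumod Q) qker.
Proof.
split=> [X||a b Da Db|a Da|c a Da|a b Da Db|a b Da Db].
- by have [a Da [_ ->]] := qrep_pres X; exists a.
- by rewrite (pres0 h).
- have [a' Da' [ea /(qmk_eq Da Da') ha]] := qrep_pres (qmk Q (f a)).
  have [b' Db' [eb /(qmk_eq Db Db') hb]] := qrep_pres (qmk Q (f b)).
  rewrite /= ea eb -(presD h Da' Db'); apply/qmk_eq; [exact: DD..|].
  by rewrite opprD addrACA; apply: qkerD => //; apply: DB.
- have [a' Da' [ea /(qmk_eq Da Da') ha]] := qrep_pres (qmk Q (f a)).
  rewrite /= ea -(presN h Da'); apply/qmk_eq; [exact: DN..|].
  by rewrite -opprD; apply: qkerN => //; apply: DB.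
- have [a' Da' [ea /(qmk_eq Da Da') ha]] := qrep_pres (qmk Q (f a)).
  rewrite /= ea -(presZ h c Da'); apply/qmk_eq; [exact: DZ..|].
  by rewrite -scalerBr; apply: qkerZ => //; apply: DB.
- have [b' Db' [eb /(qmk_eq Db Db') hb]] := qrep_pres (qmk Q (f b)).
  rewrite /= eb -(presM h Da Db'); apply/qmk_eq; [exact: DM..|].
  by rewrite -mulrBr; apply: qkerM => //; apply: DB.
- exact: qmk_eq.
Qed.

Lemma qker_ind (S : FA -> Prop) :
  (forall a, D a -> P a -> S a) -> lin_closed S ->
  (forall x, Q x -> exists2 a, D a /\ S a & x = f a) ->
  forall a, D a -> qker a -> S a.
Proof.
move=> PS Sl QS a Da ha.
have [b [Db Sb] e] : exists2 b, D b /\ S b & f a = f b.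
  apply: (@span_min N Q (fun x => exists2 b, D b /\ S b & x = f b)) ha => //.
  split.
  - by exists 0; [split=> //; case: Sl|rewrite (pres0 h)].
  - move=> y z [b [Db Sb] ->] [c [Dc Sc] ->]; exists (b + c); last by rewrite (presD h).
    by split; [apply: DD|apply: (lin_closedD Sl)].
  - move=> y [b [Db Sb] ->]; exists (- b); last by rewrite (presN h).
    by split; [apply: DN|rewrite -scaleN1r; apply: (lin_closedZ _ Sl)].
  - move=> c y [b [Db Sb] ->]; exists (c *: b); last by rewrite (presZ h).
    by split; [apply: DZ|apply: (lin_closedZ _ Sl)].
rewrite -[a](subrK b); apply: (lin_closedD Sl) => //.
by apply: PS; [apply: DB|apply/(pres_eq h)].
Qed.

End QuotientPresentation.

Lemma pres_left_ideal N f P : @pres allA N f P -> left_ideal P.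
Proof.
move=> h; have k0 a := pres_ker0 (a := a) subalg_allA h I.
split=> [|a b /k0 Pb]; last first.
  by apply/k0; rewrite (presM h) // Pb -(pres0 h) -(presM h) ?mulr0.
split=> [|c a b /k0 Pa /k0 Pb]; apply/k0; first exact: (pres0 h).
rewrite (presD h) // (presZ h) // Pa Pb -(pres0 h) -(presZ h) // -(presD h) //.
by rewrite scaler0 addr0.
Qed.

Lemma pres_FAreg : pres allA (fun a => a : FAreg) (fun a => a = 0).
Proof.
split=> //= [x|a b _ _]; first by exists x.
by split=> [->|/eqP]; rewrite ?subrr // subr_eq0 => /eqP.
Qed.

Lemma Jrel_stable (a : FA) (x : FAreg) :
  span (V := FAreg) Jrel x -> span (V := FAreg) Jrel (uact a x).
Proof.
have st : forall (b : FA) (y : FAreg), allA b -> Jrel y ->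
    span (V := FAreg) Jrel (uact b y).
  move=> b y _ [c [d [r [hr ->]]]].
  by apply: span_mem; exists (b * c), d, r; rewrite /= !mulrA.
exact: (span_stable subalg_allA pres_FAreg st I).
Qed.

Definition JU : FA -> Prop := span (V := FAreg) Jrel.

Lemma pres_Uinf : pres allA (proj : FA -> Uinf) JU.
Proof. exact: (pres_quot subalg_allA pres_FAreg (fun a x _ => @Jrel_stable a x)). Qed.

Lemma JU_rel r b : Urel r -> JU (r * b).
Proof. by move=> hr; apply: span_mem; exists 1, b, r; rewrite mul1r. Qed.

Section Verma.
Variable lam : int -> int.

Lemma uact_proj a b : uact a (proj b) = proj (a * b).
Proof. exact: (esym (presM pres_Uinf (a := a) (b := b) I I)). Qed.

Lemma uact_Uinf a b (x : Uinf) : uact a (uact b x) = uact (a * b) x.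
Proof.
have [c _ ->] := pres_surj pres_Uinf x.
by rewrite (uact_proj b c) (uact_proj a) (uact_proj (a * b)) mulrA.
Qed.

Lemma lgen_stable (S : Uinf -> Prop) a x : span (lgen S) x -> span (lgen S) (uact a x).
Proof.
have st b y : allA b -> lgen S y -> span (lgen S) (uact b y).
  move=> _ [c [s [Ss ->]]].
  apply: span_mem; exists (b * c), s.
  exact: (conj Ss (uact_Uinf b c s)).
exact: (span_stable subalg_allA pres_Uinf st I).
Qed.

Definition pM (a : FA) : Mlam lam := qmk (lgen (MS lam)) (proj a).
Definition JM : FA -> Prop := qker proj (lgen (MS lam)).

Lemma pres_Mlam : pres allA pM JM.
Proof.
exact: (pres_quot subalg_allA pres_Uinf (fun a x _ => @lgen_stable _ a x)).
Qed.

Lemma JM_left : left_ideal JM. Proof. exact: pres_left_ideal pres_Mlam. Qed.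

Lemma JM_rel r b : Urel r -> JM (r * b).
Proof.
by move=> hr; apply: (qker_sub subalg_allA pres_Uinf) => //; apply: JU_rel.
Qed.

Lemma JM_lgen a e : MS lam (proj e) -> JM (a * e).
Proof.
move=> he; apply: span_mem; exists a, (proj e).
exact: (conj he (esym (uact_proj a e))).
Qed.

Lemma JM_E i : JM (fE i).
Proof. by rewrite -[fE i]mul1r; apply: JM_lgen; exists i; left. Qed.

Lemma JM_K i : JM (fK i - (qv ^ lam i)%:A).
Proof. by rewrite -[_ - _]mul1r; apply: JM_lgen; exists i; right. Qed.

End Verma.

(** * M(lam)/I(lam) and L(lam) have the same kernel *)

Section Modules.
Variables (lam : int -> int) (hlam : dominant lam).

Definition Jint : FA -> Prop := int_ideal (U := FA_alg) lam (JM_left lam) (@JM_rel lam).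

Definition fword (s : seq int) : FA := foldr (fun j a => fF j * a) 1 s.

Lemma Jint_left : left_ideal Jint.
Proof.
exact: (int_ideal_left (U := FA_alg) qv_inj qv_neq0 hlam (JM_left lam)
  (@JM_rel lam) (@JM_E lam) (@JM_K lam)).
Qed.

Lemma Jint_sub a : JM lam a -> Jint a.
Proof. exact: (int_ideal_sub (U := FA_alg)). Qed.

Lemma Jint_F i : Jint (fF i ^+ mexp lam i).
Proof. exact: (int_ideal_gen (U := FA_alg)). Qed.

Lemma Jint_ind (S : FA -> Prop) : lin_closed S -> (forall a, JM lam a -> S a) ->
  (forall i s, S (fword s * fF i ^+ mexp lam i)) -> forall a, Jint a -> S a.
Proof. exact: (int_ideal_ind (U := FA_alg)). Qed.

Lemma Jint_max (P : FA -> Prop) a : left_ideal P ->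
  (forall b, JM lam b -> P b) -> ~ P 1 -> P a -> Jint a.
Proof.
exact: (int_ideal_max (U := FA_alg) qv_inj qv_neq0 qv_indep hlam (JM_left lam)
  (@JM_rel lam) (@JM_E lam) (@JM_K lam)).
Qed.

Lemma Jint_proper : Jint 1 -> JM lam 1.
Proof.
exact: (int_ideal_proper (U := FA_alg) qv_inj qv_neq0 (@JM_E lam) (@JM_K lam)).
Qed.

Let hM : pres allA (pM lam) (JM lam) := pres_Mlam lam.

Lemma qker_lin (N : umod) (f : FA -> N) P (Q : N -> Prop) :
  pres allA f P -> lin_closed (qker f Q).
Proof.
move=> h; split=> [|c a b ha hb]; first by rewrite /qker (pres0 h); apply: span0.
exact (qkerD h I I (qkerZ h c I ha) hb).
Qed.

Lemma uact_pM a b : uact a (pM lam b) = pM lam (a * b).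
Proof. exact: (esym (presM hM (a := a) (b := b) I I)). Qed.

Lemma FAminus_fword s : FAminus (fword s).
Proof.
apply: span_mem; exists (FMonom [seq (tF, i) | i <- s]); split.
  by rewrite /isFword all_map; apply/allP.
elim: s => [|i s IH]; first exact: (esym fmonom_nil).
by rewrite /= (fmonom_cons (tF, i)) -IH.
Qed.

(** Modulo [JM], [Jint] is spanned by F-words times the powers, which gives one inclusion; being a
    left ideal, it absorbs the coefficients from U^-, which gives the other. *)
Lemma Ilam_ker a : qker (pM lam) (Ilam (lam := lam)) a <-> Jint a.
Proof.
split; last first.
  move: a; apply: Jint_ind => [|a|i s]; first exact: qker_lin hM.
    by move=> ha; exact (qker_sub subalg_allA hM I ha).
  set m := mexp lam i.
  have -> : fword s * fF i ^+ m = qfact m *: (fword s * (Fdiv i m * 1)).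
    rewrite mulr1 /Fdiv FA_mul_scale scalerA mulfV ?scale1r //; exact: qfact_neq0.
  refine (qkerZ hM _ I _); apply: span_mem; exists (fword s), i.
  split; first exact: FAminus_fword.
  rewrite /one_lam -/(pM lam 1) (uact_pM (Fdiv i m) 1).
  exact: (esym (uact_pM (fword s) _)).
apply: (qker_ind subalg_allA hM (S := Jint)) => //.
- by move=> b _; apply: Jint_sub.
- exact: Jint_left.1.
- move=> x [b [i [_ ->]]]; exists (b * (Fdiv i (mexp lam i) * 1)).
    split=> //; apply: Jint_left.2; rewrite mulr1.
    apply: (lin_closedZ _ Jint_left.1); exact: Jint_F.
  rewrite /one_lam -/(pM lam 1) (uact_pM (Fdiv i (mexp lam i)) 1).
  exact: (uact_pM b _).
Qed.

Lemma Ilam_stable a x : span (Ilam (lam := lam)) x ->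
  span (Ilam (lam := lam)) (uact a x).
Proof.
have [b _ ->] := pres_surj hM x; rewrite (uact_pM a b) => /Ilam_ker hb.
by apply/Ilam_ker; apply: Jint_left.2.
Qed.

Lemma pres_MIlam : pres allA (fun a => qmk _ (pM lam a) : MIlam lam) Jint.
Proof.
have h := pres_quot subalg_allA hM (fun a x _ => @Ilam_stable a x).
split; [exact: (pres_surj h)|exact: (pres0 h)|exact: (presD h)|exact: (presN h)
  |exact: (presZ h)|exact: (presM h)|].
move=> a b _ _; rewrite -Ilam_ker; exact: (pres_eq h).
Qed.

Lemma submodule_ideal (P : Mlam lam -> Prop) : submodule P ->
  left_ideal (fun a => P (pM lam a)).
Proof.
move=> [P0 PD _ PZ Pact]; split=> [|a b Pb]; last by rewrite -uact_pM; apply: Pact.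
split=> [|c a b Pa Pb]; first by rewrite (pres0 hM).
rewrite (presD hM (a := c *: a) (b := b) I I) (presZ hM c (a := a) I).
exact (PD _ _ (PZ c _ Pa) Pb).
Qed.

Lemma maxsub_stable a x : span (maxsub (M := Mlam lam)) x ->
  span (maxsub (M := Mlam lam)) (uact a x).
Proof.
have st b y : allA b -> maxsub y -> span (maxsub (M := Mlam lam)) (uact b y).
  move=> _ [P [hP [nP Py]]]; apply: span_mem; exists P; split=> //; split=> //.
  by case: hP => _ _ _ _; apply.
exact: (span_stable subalg_allA hM st I).
Qed.

(** Proper submodules lie in I(lam) by [Jint_max]; conversely I(lam) is one of the submodules
    summed, as soon as it is proper. *)
Lemma maxsub_ker a : qker (pM lam) (maxsub (M := Mlam lam)) a <-> Jint a.
Proof.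
split.
  apply: (qker_ind subalg_allA hM (S := Jint)) => //.
  - by move=> b _; apply: Jint_sub.
  - exact: Jint_left.1.
  - move=> x [P [hP [[y nPy] Px]]]; have [b _ xE] := pres_surj hM x.
    exists b => //; split=> //.
    apply: (Jint_max (submodule_ideal hP)) => [c /(pres_ker0 subalg_allA hM I)||].
    + by move=> ->; case: hP.
    + move=> P1; apply: nPy; have [c _ ->] := pres_surj hM y.
      rewrite -[c]mulr1 -uact_pM; by case: hP => _ _ _ _; apply.
    + by rewrite -xE.
move=> ha.
have [[y ny]|all] := classic (exists y, ~ span (Ilam (lam := lam)) y).
  apply: span_mem; exists (span (Ilam (lam := lam))); split.
    split; [exact: span0|exact: spanD|exact: spanN|exact: spanZ|exact: Ilam_stable].
  by split; [exists y|apply/Ilam_ker].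
(* If I(lam) is everything, then 1 lies in [Jint], hence in [JM]: M(lam) is zero and nothing remains
   to compare. *)
refine (qker_sub subalg_allA hM I _).
have J1 : JM lam 1.
  apply: Jint_proper.
  have [h1|n1] := classic (qker (pM lam) (Ilam (lam := lam)) 1).
    exact (proj1 (Ilam_ker 1) h1).
  by case: all; exists (pM lam 1).
by rewrite -[a]mulr1; apply: (JM_left lam).2.
Qed.

Lemma pres_Llam : pres allA (fun a => qmk _ (pM lam a) : Llam lam) Jint.
Proof.
have h := pres_quot subalg_allA hM (fun a x _ => @maxsub_stable a x).
split; [exact: (pres_surj h)|exact: (pres0 h)|exact: (presD h)|exact: (presN h)
  |exact: (presZ h)|exact: (presM h)|].
move=> a b _ _; rewrite -maxsub_ker; exact: (pres_eq h).
Qed.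

End Modules.

(** * The direct limit *)

Lemma FAn_lin n : lin_closed (FAn n).
Proof.
split=> [|c a b ha hb]; first exact (@span0 FAspace _).
exact (@spanD FAspace _ _ _ (@spanZ FAspace _ c _ ha) hb).
Qed.

Lemma FAn_word n (w : fmonom gen) : all (inrange n) w -> FAn n << w >>.
Proof. by move=> hw; apply: (@span_mem FAspace); exists w. Qed.

Lemma FAn_ind n (S : FA -> Prop) : lin_closed S ->
  (forall w : fmonom gen, all (inrange n) w -> S << w >>) -> forall a, FAn n a -> S a.
Proof.
move=> Sl Sw a; apply: (@span_min FAspace _ S) => [|y [w [hw ->]]]; last exact: Sw.
split=> [|y z|y|c y] /=.
- by case: Sl.
- exact: lin_closedD.
- by move=> hy; rewrite -scaleN1r; apply: (lin_closedZ _ Sl).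
- exact: lin_closedZ.
Qed.

Lemma FAn_mul n a b : FAn n a -> FAn n b -> FAn n (a * b).
Proof.
move=> ha hb; move: a ha; apply: FAn_ind => [|w hw].
  split=> [|c x y hx hy]; first by rewrite mul0r; case: (FAn_lin n).
  have -> : (c *: x + y) * b = c *: (x * b) + y * b by rewrite mulrDl scalerAl.
  exact ((FAn_lin n).2 c _ _ hx hy).
move: b hb; apply: FAn_ind => [|w' hw'].
  split=> [|c x y hx hy]; first by rewrite mulr0; case: (FAn_lin n).
  have -> : << w >> * (c *: x + y) = c *: (<< w >> * x) + << w >> * y.
    by rewrite mulrDr FA_mul_scale.
  exact ((FAn_lin n).2 c _ _ hx hy).
by rewrite fmonom_cat; apply: FAn_word; rewrite all_cat hw.
Qed.

Lemma FAn_subalg n : subalg (FAn n).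
Proof. by split; [exact: FAn_lin|move=> a b; exact: FAn_mul]. Qed.

Lemma inrange_mono m n g : (m <= n)%N -> inrange m g -> inrange n g.
Proof.
move=> mn; rewrite /inrange; case: ifP => _ /andP[h1 h2]; apply/andP; split; lia.
Qed.

Lemma FAn_mono m n a : (m <= n)%N -> FAn m a -> FAn n a.
Proof.
move=> mn; move: a; apply: FAn_ind => [|w hw]; first exact: FAn_lin.
by apply: FAn_word; apply: sub_all hw => g; apply: inrange_mono.
Qed.

Lemma FAn_gen n g : inrange n g -> FAn n (fgen g).
Proof.
by move=> hg; apply: FAn_word; rewrite fmU /= hg.
Qed.

Lemma inrange_ex g : exists n, inrange n g.
Proof.
exists (absz g.2).+1; rewrite /inrange; case: ifP => _; apply/andP; split; lia.
Qed.

Lemma FAn_ex a : exists n, FAn n a.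
Proof.
move: a; apply: FA_ind => [||g a [n ha]].
- split=> [|c a b [n ha] [m hb]]; first by exists 0%N; case: (FAn_lin 0).
  exists (n + m)%N.
  exact ((FAn_lin (n + m)).2 c _ _ (FAn_mono (leq_addr _ _) ha)
    (FAn_mono (leq_addl _ _) hb)).
- exists 0%N; rewrite -fmonom_nil; exact: FAn_word.
- have [m hg] := inrange_ex g; exists (n + m)%N; apply: FAn_mul.
    by apply: FAn_gen; apply: inrange_mono hg; rewrite leq_addl.
  by apply: FAn_mono ha; rewrite leq_addr.
Qed.

Lemma levelP a : FAn (level a) a.
Proof.
rewrite /level; case: excluded_middle_informative => [h|[]]; last exact: FAn_ex.
by case: constructive_indefinite_description.
Qed.

Lemma sumod_actE (M : umod) (P : M -> Prop) a (x : sumod P) :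
  span P (uact a (proj1_sig x)) ->
  proj1_sig (uact a x) = uact a (proj1_sig x).
Proof.
by move=> h; rewrite /= /sact; case: excluded_middle_informative.
Qed.

Section Level.
Variable n : nat.

(** At level [n.+1] this is convertible to [Un_incl n], which lets the transition maps be computed.
    The default zero is not reached on [proj a] with [FAn n a]. *)
Definition umk (u : Uinf) : Unmod n :=
  match excluded_middle_informative (span (Un n) u) with
  | left h => exist (fun x => span (Un n) x) u h
  | right _ => szero (Unmod n)
  end.

Lemma Unmod_inj (x y : Unmod n) : proj1_sig x = proj1_sig y -> x = y.
Proof.
case: x y => x hx [y hy] /= e; move: hx hy; rewrite e => hx hy.
by congr exist; apply: proof_irrelevance.
Qed.

Lemma Un_proj a : FAn n a -> span (Un n) (proj a).
Proof. by move=> ha; apply: span_mem; exists a. Qed.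

Lemma umkE a : FAn n a -> proj1_sig (umk (proj a)) = proj a.
Proof.
move=> ha; rewrite /umk; case: excluded_middle_informative => // h.
by case: h; apply: Un_proj.
Qed.

Lemma Un_spanP u : span (Un n) u -> exists2 a, FAn n a & u = proj a.
Proof.
have h := pres_Uinf; have cl := FAn_lin n.
apply: (@span_min Uinf _ (fun u => exists2 a, FAn n a & u = proj a)) => [|v [a [ha ->]]];
  last by exists a.
split.
- by exists 0; [case: cl|exact (esym (pres0 h))].
- move=> y z [a ha ->] [b hb ->]; exists (a + b); first exact (lin_closedD cl ha hb).
  exact (esym (presD h (a := a) (b := b) I I)).
- move=> y [a ha ->]; exists (- a).
    by rewrite -scaleN1r; exact (lin_closedZ (-1) cl ha).
  exact (esym (presN h (a := a) I)).
- move=> c y [a ha ->]; exists (c *: a); first exact (lin_closedZ c cl ha).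
  exact (esym (presZ h c (a := a) I)).
Qed.

Lemma umk_surj (x : Unmod n) : exists2 a, FAn n a & x = umk (proj a).
Proof.
have [a ha e] := Un_spanP (proj2_sig x); exists a => //.
apply: Unmod_inj; rewrite (umkE ha); exact e.
Qed.

Lemma sactE a (x : Unmod n) : FAn n a ->
  proj1_sig (uact a x) = uact a (proj1_sig x).
Proof.
move=> ha; have [b hb ->] := umk_surj x.
have e : uact a (proj1_sig (umk (proj b))) = proj (a * b).
  rewrite (umkE hb); exact (uact_proj a b).
apply: sumod_actE; rewrite e; apply: Un_proj; exact: FAn_mul.
Qed.

Lemma pres_Un : pres (FAn n) (fun a => umk (proj a) : Unmod n) JU.
Proof.
have h := pres_Uinf; have cl := FAn_lin n; have hD := FAn_subalg n.
split=> [x||a b ha hb|a ha|c a ha|a b ha hb|a b ha hb].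
- exact: umk_surj.
- apply: Unmod_inj; rewrite umkE; last by case: cl.
  exact (pres0 h).
- apply: Unmod_inj; rewrite umkE; last exact (lin_closedD cl ha hb).
  change (proj (a + b)
    = sadd (proj1_sig (umk (proj a))) (proj1_sig (umk (proj b)))).
  rewrite (umkE ha) (umkE hb); exact (presD h (a := a) (b := b) I I).
- apply: Unmod_inj; rewrite umkE.
    change (proj (- a) = sopp (proj1_sig (umk (proj a)))).
    rewrite (umkE ha); exact (presN h (a := a) I).
  by rewrite -scaleN1r; exact (lin_closedZ (-1) cl ha).
- apply: Unmod_inj; rewrite umkE; last exact (lin_closedZ c cl ha).
  change (proj (c *: a) = sscale c (proj1_sig (umk (proj a)))).
  rewrite (umkE ha); exact (presZ h c (a := a) I).
- apply: Unmod_inj.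
  apply: (etrans (umkE (FAn_mul ha hb))); apply: esym.
  apply: (etrans (sactE (umk (proj b)) ha)); rewrite (umkE hb).
  exact (uact_proj a b).
- rewrite -(pres_eq h (a := a) (b := b) I I); split=> [e|e]; last by rewrite e.
  rewrite -(umkE ha) e; exact (umkE hb).
Qed.

Variable lam : int -> int.

Lemma In_stable a x : FAn n a -> span (In lam (n := n)) x ->
  span (In lam (n := n)) (uact a x).
Proof.
apply: (span_stable (FAn_subalg n) pres_Un) => {x}b x hb [c [s [hc [hs e]]]].
apply: span_mem; exists (b * c), s; split; first exact: FAn_mul.
split; first exact hs.
rewrite (sactE _ hb) e; exact (uact_Uinf b c s).
Qed.

Definition psi (a : FA) : Ln lam n := qmk (In lam (n := n)) (umk (proj a)).
(** To be read together with [FAn n]: elsewhere [umk] may return its default. *)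
Definition Kd : FA -> Prop := qker (fun a => umk (proj a)) (In lam (n := n)).

Lemma pres_Ln : pres (FAn n) psi Kd.
Proof. exact: (pres_quot (FAn_subalg n) pres_Un In_stable). Qed.

Lemma Kd_lin : lin_closed (fun a => FAn n a /\ Kd a).
Proof.
have cl := FAn_lin n; split=> [|c a b [ha ka] [hb kb]].
  split; first by case: cl.
  rewrite /Kd /qker (pres0 pres_Un); exact: span0.
have hca : FAn n (c *: a) := lin_closedZ c cl ha.
split; first exact (lin_closedD cl hca hb).
exact (qkerD pres_Un hca hb (qkerZ pres_Un c ha ka) kb).
Qed.

End Level.

Lemma dmk_ext (L : nat -> umod) (f : forall n, L n -> L n.+1) p q :
  drel f p = drel f q -> dmk f p = dmk f q.
Proof.
rewrite /dmk; move: (ex_intro _ _ _) (ex_intro _ _ _) => /= h1 h2 e.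
by move: h1 h2; rewrite e => h1 h2; congr exist; apply: proof_irrelevance.
Qed.

Lemma dmk_rep (L : nat -> umod) (f : forall n, L n -> L n.+1) (X : dcar f) :
  dmk f (drep X) = X.
Proof.
rewrite /dmk /drep; case: constructive_indefinite_description => p /= e.
case: X e => Y q /= e; move: (ex_intro _ _ _); rewrite -e => q'.
by congr exist; apply: proof_irrelevance.
Qed.

Section Representatives.
Variables (L : nat -> umod) (f : forall n, L n -> L n.+1) (lev : FA -> nat).

Lemma dadd_rep (X Y : dspace f) n x m y :
  drep X = existT L n x -> drep Y = existT L m y ->
  sadd X Y = dmk f (existT L (Nat.add m n) (sadd (up f m x)
    (eq_rect _ L (up f n y) _ (PeanoNat.Nat.add_comm n m)))).
Proof. by move=> e1 e2; rewrite /= /dadd e1 e2. Qed.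

Lemma dopp_rep (X : dspace f) n x : drep X = existT L n x ->
  sopp X = dmk f (existT L n (sopp x)).
Proof. by move=> e; rewrite /= e. Qed.

Lemma dscale_rep c (X : dspace f) n x : drep X = existT L n x ->
  sscale c X = dmk f (existT L n (sscale c x)).
Proof. by move=> e; rewrite /= e. Qed.

Lemma dact_rep a (X : dumod f lev) n x : drep X = existT L n x ->
  uact a X = dmk f (existT L (Nat.add (lev a) n) (uact a (up f (lev a) x))).
Proof. by move=> e; rewrite /= /dact e. Qed.

End Representatives.

Section DirectLimit.
Variable lam : int -> int.
Local Notation psi n := (@psi n lam).
Local Notation Kd n := (@Kd n lam).
Local Notation Lm := (@Lmap lam).

Lemma Sn_mono m n s : (m <= n)%N -> Sn lam m s -> Sn lam n s.
Proof.
move=> mn [i h]; exists i; case: h => -[/andP[h1 h2] hs]; [left|right];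
  split=> //; apply/andP; split; lia.
Qed.

Lemma Kd_mono m n a : (m <= n)%N -> FAn m a -> Kd m a -> Kd n a.
Proof.
move=> mn ha ka.
suff [] : FAn n a /\ Kd n a by [].
move: a ha ka.
apply: (qker_ind (FAn_subalg m) (pres_Un m) (S := fun a => FAn n a /\ Kd n a)).
- move=> a ha ja; have ha' := FAn_mono mn ha; split=> //.
  exact (qker_sub (FAn_subalg n) (pres_Un n) ha' ja).
- exact: Kd_lin.
- move=> x [c [s [hc [hs e]]]]; have [a ha xE] := umk_surj x.
  have ha' := FAn_mono mn ha.
  exists a => //; split=> //; split=> //; apply: span_mem; exists c, s.
  split; first exact: FAn_mono hc.
  split; first exact: Sn_mono hs.
  rewrite (umkE ha') -e xE; exact (esym (umkE ha)).
Qed.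

Lemma psi_eq n a b : FAn n a -> FAn n b -> psi n a = psi n b <-> Kd n (a - b).
Proof. exact: (pres_eq (pres_Ln n lam)). Qed.

Lemma psi_surj n (X : Ln lam n) : exists2 a, FAn n a & X = psi n a.
Proof. exact: (pres_surj (pres_Ln n lam)). Qed.

Lemma Lmap_psi n a : FAn n a -> Lm (psi n a) = psi n.+1 a.
Proof.
move=> ha; have [b hb [e eX]] := qrep_pres (pres_Un n) (psi n a).
have nn := leqnSn n; have hb' := FAn_mono nn hb; have ha' := FAn_mono nn ha.
have -> : Lm (psi n a) = psi n.+1 b.
  have u : proj1_sig (qrep (psi n a)) = proj b.
    by rewrite e; exact (umkE hb).
  exact (congr1 (fun u => qmk (In lam (n := n.+1)) (umk n.+1 u)) u).
apply (proj2 (psi_eq hb' ha')).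
apply: (Kd_mono nn); first exact (lin_closedB (FAn_lin n) hb ha).
exact (proj1 (psi_eq hb ha) (esym eX)).
Qed.

Lemma up_psi n d a : FAn n a ->
  up Lm d (psi n a) = psi (Nat.add d n) a.
Proof.
move=> ha; elim: d => [|d IH]; first exact (erefl (psi n a)).
change (Lm (up Lm d (psi n a)) = psi (Nat.add d n).+1 a); rewrite IH.
exact (Lmap_psi (FAn_mono (leq_addl d n) ha)).
Qed.

Lemma psi_cast p q (H : p = q) a : eq_rect p (Ln lam) (psi p a) q H = psi q a.
Proof. by case: q / H. Qed.

Definition JD (a : FA) := exists n, FAn n a /\ Kd n a.

Lemma JD_lin : lin_closed JD.
Proof.
split=> [|c a b [n [ha ka]] [m [hb kb]]].
  by exists 0%N; case: (Kd_lin 0 lam).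
have nl := leq_addr m n; have ml := leq_addl n m.
exists (n + m)%N; case: (Kd_lin (n + m) lam) => _; apply.
  by split; [exact: FAn_mono ha|exact: Kd_mono ka].
by split; [exact: FAn_mono hb|exact: Kd_mono kb].
Qed.

Lemma drelE n m a b : FAn n a -> FAn m b ->
  drel Lm (existT _ n (psi n a)) (existT _ m (psi m b)) <-> JD (a - b).
Proof.
move=> ha hb; split.
  move=> [d [e [H]]]; rewrite /= in H *.
  rewrite up_psi // up_psi // psi_cast => h.
  have ha' : FAn (Nat.add e m) a.
    by rewrite -H; apply: FAn_mono ha; exact: leq_addl.
  have hb' : FAn (Nat.add e m) b by apply: FAn_mono hb; exact: leq_addl.
  exists (Nat.add e m); split; first exact: (lin_closedB (FAn_lin _)).
  exact/psi_eq.
move=> [N [hN kN]].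
have H : Nat.add (N + m) n = Nat.add (N + n) m by rewrite -!plusE; lia.
(* Both sides are lifted to level N + m + n, beyond the level [N] at which the difference
   vanishes. *)
exists (N + m)%N, (N + n)%N, H; rewrite /= up_psi // up_psi // psi_cast.
have nl : (n <= Nat.add (N + n) m)%N by rewrite -H; exact: leq_addl.
have ml : (m <= Nat.add (N + n) m)%N by exact: leq_addl.
have Nl : (N <= Nat.add (N + n) m)%N by apply: leq_trans (leq_addr _ _) (leq_addr _ _).
apply/psi_eq; [exact: FAn_mono ha|exact: FAn_mono hb|exact: Kd_mono kN].
Qed.

Definition Dpt n a : Dlim lam := dmk Lm (existT (Ln lam) n (psi n a)).

Lemma pair_surj (p : {n : nat & Ln lam n}) :
  exists n a, FAn n a /\ p = existT _ n (psi n a).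
Proof. by case: p => n X; have [a ha ->] := psi_surj X; exists n, a. Qed.

Lemma Dpt_eq n m a b : FAn n a -> FAn m b -> Dpt n a = Dpt m b <-> JD (a - b).
Proof.
move=> ha hb; split.
  move=> E; apply (proj1 (drelE ha hb)).
  (* Equal classes have the same members, and [r] belongs to its own class. *)
  set r := existT (Ln lam) m (psi m b).
  have e : drel Lm (existT (Ln lam) n (psi n a)) r = drel Lm r r
    := congr1 (fun X : Dlim lam => proj1_sig X r) E.
  rewrite e; apply (proj2 (drelE hb hb)).
  by rewrite subrr; case: JD_lin.
move=> hab; apply: dmk_ext.
apply: functional_extensionality => r; apply: propositional_extensionality.
have [l [c [hc ->]]] := pair_surj r.
split=> h.
  apply (proj2 (drelE hb hc)); move: (proj1 (drelE ha hc) h) => {}h.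
  have -> : b - c = (a - c) - (a - b) by rewrite opprB [RHS]addrC addrA subrK.
  exact (lin_closedB JD_lin h hab).
apply (proj2 (drelE ha hc)); move: (proj1 (drelE hb hc) h) => {}h.
have -> : a - c = (a - b) + (b - c) by rewrite addrA subrK.
exact (lin_closedD JD_lin hab h).
Qed.

Lemma drep_Dpt (X : Dlim lam) : exists n a,
  [/\ FAn n a, drep X = existT (Ln lam) n (psi n a) & X = Dpt n a].
Proof.
have [n [a [ha e]]] := pair_surj (drep X); exists n, a; split=> //.
by rewrite /Dpt -e; exact (esym (dmk_rep X)).
Qed.

Definition Phi a : Dlim lam := Dpt (level a) a.

Lemma Dpt_Phi n a : FAn n a -> Dpt n a = Phi a.
Proof.
move=> ha; apply (proj2 (Dpt_eq ha (@levelP a))).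
by rewrite subrr; case: JD_lin.
Qed.

Lemma Phi_eq a b : Phi a = Phi b <-> JD (a - b).
Proof. exact: (Dpt_eq (@levelP a) (@levelP b)). Qed.

Lemma drep_Phi a : exists n b,
  [/\ FAn n b, drep (Phi a) = existT (Ln lam) n (psi n b) & JD (a - b)].
Proof.
have [n [b [hb e eX]]] := drep_Dpt (Phi a); exists n, b.
exact (And3 hb e (proj1 (Phi_eq a b) (etrans eX (Dpt_Phi hb)))).
Qed.

Lemma Phi_add a b : Phi (a + b) = sadd (Phi a) (Phi b).
Proof.
have [n [a' [ha ea ja]]] := drep_Phi a; have [m [b' [hb eb jb]]] := drep_Phi b.
rewrite (dadd_rep ea eb) (up_psi m ha) (up_psi n hb) psi_cast.
have ha' : FAn (Nat.add m n) a' by apply: FAn_mono ha; exact: leq_addl.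
have hb' : FAn (Nat.add m n) b' by apply: FAn_mono hb; exact: leq_addr.
have hab : FAn (Nat.add m n) (a' + b') by apply: (lin_closedD (FAn_lin _)).
rewrite -(presD (pres_Ln (Nat.add m n) lam) ha' hb').
transitivity (Dpt (Nat.add m n) (a' + b')); last exact (erefl _).
rewrite (Dpt_Phi hab); apply (proj2 (Phi_eq _ _)).
by rewrite opprD addrACA; apply: (lin_closedD JD_lin).
Qed.

Lemma Phi_opp a : Phi (- a) = sopp (Phi a).
Proof.
have [n [b [hb e jb]]] := drep_Phi a.
rewrite (dopp_rep e) -(presN (pres_Ln n lam) hb).
have hb' : FAn n (- b) by rewrite -scaleN1r; apply: (lin_closedZ _ (FAn_lin _)).
transitivity (Dpt n (- b)); last exact (erefl _).
rewrite (Dpt_Phi hb'); apply (proj2 (Phi_eq _ _)); rewrite -opprD -scaleN1r.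
exact: (lin_closedZ _ JD_lin).
Qed.

Lemma Phi_scale c a : Phi (c *: a) = sscale c (Phi a).
Proof.
have [n [b [hb e jb]]] := drep_Phi a.
rewrite (dscale_rep c e) -(presZ (pres_Ln n lam) c hb).
have hb' : FAn n (c *: b) by apply: (lin_closedZ _ (FAn_lin _)).
transitivity (Dpt n (c *: b)); last exact (erefl _).
rewrite (Dpt_Phi hb'); apply (proj2 (Phi_eq _ _)); rewrite -scalerBr.
exact: (lin_closedZ _ JD_lin).
Qed.

(** The action replaces [b] by a representative chosen at another level, so the error in [JD] gets
    multiplied by [a]. The identification with [Jint] will supply this property. *)
Hypothesis JD_left : left_ideal JD.

Lemma Phi_act a b : Phi (a * b) = uact a (Phi b).
Proof.
have [n [b' [hb e jb]]] := drep_Phi b.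
rewrite (dact_rep (lev := level) a e) (up_psi (level a) hb).
set N := Nat.add (level a) n.
have ha : FAn N a by apply: FAn_mono (@levelP a); exact: leq_addr.
have hb' : FAn N b' by apply: FAn_mono hb; exact: leq_addl.
rewrite -(presM (pres_Ln N lam) ha hb').
transitivity (Dpt N (a * b')); last exact (erefl _).
rewrite (Dpt_Phi (FAn_mul ha hb')); apply (proj2 (Phi_eq _ _)); rewrite -mulrBr.
exact: JD_left.2.
Qed.

Lemma pres_Dlim : pres allA Phi JD.
Proof.
split=> [X||a b _ _|a _|c a _|a b _ _|a b _ _].
- have [n [a [ha _ ->]]] := drep_Dpt X.
  exact (ex_intro2 _ _ a I (Dpt_Phi ha)).
- have h0 : FAn 0 0 by case: (FAn_lin 0).
  rewrite -(Dpt_Phi h0) /Dpt; have e := pres0 (pres_Ln 0 lam).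
  exact (congr1 (fun x => dmk Lm (existT (Ln lam) 0%N x)) e).
- exact: Phi_add.
- exact: Phi_opp.
- exact: Phi_scale.
- exact: Phi_act.
- exact: Phi_eq.
Qed.

End DirectLimit.

(** * The kernel of the direct limit is that of M(lam)/I(lam) *)

Section Comparison.
Variables (lam : int -> int) (hlam : dominant lam).

(** Each generator of I_n is a relation of M(lam) or one of the powers generating I(lam), and [Jint]
    is a left ideal of the whole algebra. *)
Lemma Kd_Jint n a : FAn n a -> Kd n lam a -> Jint lam a.
Proof.
have Jl := Jint_left hlam.
have UJ b : JU b -> Jint lam b.
  by move=> hb; apply: Jint_sub; exact (qker_sub subalg_allA pres_Uinf I hb).
move: a; apply: (qker_ind (FAn_subalg n) (pres_Un n) (S := Jint lam)).
- by move=> a _; exact: UJ.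
- exact: Jl.1.
- move=> x [c [s [hc [[i hs] e]]]]; have [a ha xE] := umk_surj x.
  have [d sE Jd] : exists2 d, s = proj d & Jint lam d.
    case: hs => [[_ [->|->]]|[_ ->]].
    + by exists (fE i) => //; apply: Jint_sub; apply: JM_E.
    + by exists (fF i ^+ mexp lam i) => //; apply: Jint_F.
    + by exists (fK i - (qv ^ lam i)%:A) => //; apply: Jint_sub; apply: JM_K.
  have ea : proj a = proj (c * d).
    rewrite -(umkE ha) -xE e sE; exact (uact_proj c d).
  exists a; last exact xE.
  split; first exact ha.
  rewrite -[a](subrK (c * d)).
  apply: (lin_closedD Jl.1); last exact (Jl.2 c d Jd).
  exact (UJ _ (proj1 (pres_eq pres_Uinf (a := a) (b := c * d) I I) ea)).
Qed.

(** I_n allows only coefficients of level n, but any coefficient has some level, and generators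
    remain generators at higher levels. *)
Lemma JD_gen n a d : Sn lam n (proj d) -> JD lam (a * d).
Proof.
move=> hs; pose N := (level a + level d + n)%N.
have ha : FAn N a by apply: FAn_mono (@levelP a); rewrite /N -addnA leq_addr.
have hd : FAn N d.
  by apply: FAn_mono (@levelP d); rewrite /N addnAC leq_addl.
have had := FAn_mul ha hd.
exists N; split; first exact had.
apply: span_mem; exists a, (proj d); split; first exact ha.
split; first exact (Sn_mono (leq_addl _ _) hs).
rewrite (umkE had); exact (esym (uact_proj a d)).
Qed.

Lemma JM_JD a : JM lam a -> JD lam a.
Proof.
move: a.
have S1 a : allA a -> JU a -> JD lam a.
  move=> _ ja; exists (level a); split; first exact (@levelP a).
  exact (qker_sub (FAn_subalg _) (pres_Un _) (@levelP a) ja).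
have S3 x : lgen (MS lam) x -> exists2 a, allA a /\ JD lam a & x = proj a.
  move=> [a [s [[i hs] ->]]].
  have hi : (- (absz i).+1%:Z <= i) && (i < (absz i).+1%:Z) by lia.
  have hi' : (- (absz i).+1%:Z <= i) && (i <= (absz i).+1%:Z) by lia.
  case: hs => ->.
    exists (a * fE i); last exact (uact_proj a (fE i)).
    split; first by [].
    by apply: (@JD_gen (absz i).+1); exists i; left; split=> //; left.
  exists (a * (fK i - (qv ^ lam i)%:A)); last exact (uact_proj a _).
  split; first by [].
  by apply: (@JD_gen (absz i).+1); exists i; right.
move=> a.
exact (@qker_ind _ subalg_allA _ _ _ pres_Uinf _ (JD lam) S1 (JD_lin lam) S3 a I).
Qed.

Lemma JD_Jint a : JD lam a <-> Jint lam a.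
Proof.
split=> [[n [ha ka]]|]; first exact: (Kd_Jint ha ka).
move: a; apply: Jint_ind => [|a|i s]; first exact: JD_lin.
  exact: JM_JD.
apply: (@JD_gen (absz i).+1); exists i; left; split; first by lia.
by right.
Qed.

Lemma JD_left : left_ideal (JD lam).
Proof.
split=> [|a b /JD_Jint hb]; first exact: JD_lin.
by apply (proj2 (JD_Jint _)); exact ((Jint_left hlam).2 a b hb).
Qed.

End Comparison.

Theorem theorem9p7 (lam : int -> int) (hlam : dominant lam) :
  umod_iso (Llam lam) (Dlim lam) /\ umod_iso (Dlim lam) (MIlam lam).
Proof.
have hD := pres_Dlim (JD_left hlam); split.
  apply: (pres_iso (pres_Llam hlam) hD) => a.
  exact (iff_sym (JD_Jint hlam a)).
exact: (pres_iso hD (pres_MIlam hlam) (JD_Jint hlam)).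
Qed.
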